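(* Let $\mathfrak g$ be a semisimple Lie algebra over an algebraically closed field $\Bbbk$ of characteristic $0$, and let $\sigma_1,\sigma_2,\sigma_3$ be involutions of $\mathfrak g$ with $\sigma_1\sigma_2=\sigma_2\sigma_1$, $\sigma_1\neq\sigma_2$ and $\sigma_3=\sigma_1\sigma_2$. For $i,j\in\{0,1\}$ let $\mathfrak g_{ij}=\{x\in\mathfrak g:\sigma_1(x)=(-1)^ix,\ \sigma_2(x)=(-1)^jx\}$. Suppose that $\sigma_1$ is of maximal rank. Then: (1) every Cartan subspace $\mathfrak c_{11}$ of $\mathfrak g_{11}$ is also a Cartan subspace of $\mathfrak g_{01}\oplus\mathfrak g_{11}$ (the $(-1)$-eigenspace of $\sigma_2$); (2) every Cartan subspace $\mathfrak c_{10}$ of $\mathfrak g_{10}$ is also a Cartan subspace of $\mathfrak g_{10}\oplus\mathfrak g_{01}$ (the $(-1)$-eigenspace of $\sigma_3$).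
   Context: Involutions are Lie algebra automorphisms of order $2$ (assumed induced from involutions of a connected semisimple group $G$ with Lie algebra $\mathfrak g$). For an involution $\sigma$ of a reductive Lie algebra $\mathfrak h=\mathfrak h_0\oplus\mathfrak h_1$ ($\mathfrak h_i$ the $(-1)^i$-eigenspace), a Cartan subspace of $\mathfrak h_1$ is a maximal subspace of $\mathfrak h_1$ consisting of pairwise commuting semisimple elements. Here $\mathfrak g_{11}$ is the $(-1)$-eigenspace of the involution induced by $\sigma_2$ on $\mathfrak g^{\sigma_1\sigma_2}=\mathfrak g_{00}\oplus\mathfrak g_{11}$, and $\mathfrak g_{10}$ is the $(-1)$-eigenspace of the involution induced on $\mathfrak g^{\sigma_2}=\mathfrak g_{00}\oplus\mathfrak g_{10}$. An involution $\sigma$ of $\mathfrak g$ is of maximal rank if its $(-1)$-eigenspace contains a Cartan subalgebra of $\mathfrak g$. *)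

(* Defs.v *)
From HB Require Import structures.
From mathcomp Require Import all_boot all_order all_algebra.
Set Implicit Arguments. Unset Strict Implicit. Unset Printing Implicit Defensive.
Import Order.TTheory GRing.Theory Num.Theory.
Local Open Scope ring_scope.

(* A finite-dimensional Lie algebra over F is modelled as F^n = 'rV[F]_n with
   a bracket br.  Subspaces are represented by the row spaces of n x n matrices
   (mxalgebra, scope %MS). Linear maps act on row vectors on the right. *)

Section Lie.
Variables (F : fieldType) (n : nat).
Local Notation V := 'rV[F]_n.
Variable br : V -> V -> V.

Definition lie_algebra : Prop :=
  [/\ (forall a x y z, br (a *: x + y) z = a *: br x z + br y z),
      (forall a x y z, br z (a *: x + y) = a *: br z x + br z y),
      (forall x, br x x = 0) &
      (forall x y z, br x (br y z) + br y (br z x) + br z (br x y) = 0)].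

Definition brspan (U W : 'M[F]_n) : 'M[F]_n :=
  (\sum_(i < n) \sum_(j < n) <<br (row i U) (row j W)>>)%MS.

Definition subalgebra (U : 'M[F]_n) : Prop :=
  forall x y : V, (x <= U)%MS -> (y <= U)%MS -> (br x y <= U)%MS.

Definition lie_ideal (I : 'M[F]_n) : Prop :=
  forall x y : V, (y <= I)%MS -> (br x y <= I)%MS.

Definition solvable_sub (I : 'M[F]_n) : Prop :=
  exists k, \rank (iter k (fun U => brspan U U) I) = 0%N.

Definition nilpotent_sub (h : 'M[F]_n) : Prop :=
  exists k, \rank (iter k (brspan h) h) = 0%N.

Definition semisimple_lie : Prop :=
  forall I, lie_ideal I -> solvable_sub I -> \rank I = 0%N.

Definition ad (x : V) : 'M[F]_n := lin1_mx (br x).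

Definition diagonalizable_mx (A : 'M[F]_n) : Prop :=
  exists2 P : 'M[F]_n, P \in unitmx & is_diag_mx (P *m A *m invmx P).

Definition semisimple_elt (x : V) : Prop := diagonalizable_mx (ad x).

Definition cartan_subalgebra (h : 'M[F]_n) : Prop :=
  [/\ subalgebra h, nilpotent_sub h &
      forall x : V, (forall y : V, (y <= h)%MS -> (br x y <= h)%MS) -> (x <= h)%MS].

Definition lie_aut (s : 'M[F]_n) : Prop :=
  s \in unitmx /\ forall x y : V, br (x *m s) (y *m s) = br x y *m s.

Definition involution (s : 'M[F]_n) : Prop :=
  [/\ lie_aut s, s *m s = 1%:M & s != 1%:M].

Definition eigsp (s : 'M[F]_n) (a : F) : 'M[F]_n := kermx (s - a%:M).

Definition maximal_rank (s : 'M[F]_n) : Prop :=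
  exists2 h, cartan_subalgebra h & (h <= eigsp s (-1))%MS.

Definition comm_ss_subspace (C : 'M[F]_n) : Prop :=
  (forall x y : V, (x <= C)%MS -> (y <= C)%MS -> br x y = 0) /\
  (forall x : V, (x <= C)%MS -> semisimple_elt x).

Definition cartan_subspace (W C : 'M[F]_n) : Prop :=
  [/\ (C <= W)%MS, comm_ss_subspace C &
      forall D : 'M[F]_n, (C <= D)%MS -> (D <= W)%MS -> comm_ss_subspace D ->
        (D <= C)%MS].

Definition gij (s1 s2 : 'M[F]_n) (i j : nat) : 'M[F]_n :=
  (eigsp s1 ((-1) ^+ i) :&: eigsp s2 ((-1) ^+ j))%MS.

End Lie.

(* Main.v *)
From HB Require Import structures.
Require Import Defs.
From mathcomp Require Import all_boot all_order all_algebra.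
From mathcomp Require Import ring zify.
Set Implicit Arguments. Unset Strict Implicit. Unset Printing Implicit Defensive.
Import Order.TTheory GRing.Theory Num.Theory.
Local Open Scope ring_scope.

(* Let [c] be a Cartan subspace of [g_11], with generic element [x] and centralizer [l = z(x) = z(c)].  Jordan
   decomposition and the nondegeneracy of the Killing form give [l_11 = c], so it remains to see that
   [l_01 = 0].  As [x] is semisimple, [g_1 = l_1 + [g_0, x]] for the grading by [sigma_1], so the [G_0]-saturation
   of [l_1] is dense in [g_1], and a lower bound for the nullity of [(ad u)^2] on [l_1] extends to [g_1].  For
   [u] in [l_1] the kernel of [(ad u)^2] contains [l_01], [c] and the kernel of [ad u] on [l_10]; by the
   Kostant-Rallis identity [dim z_1(y) - dim z_0(y) = dim g_1 - dim g_0], valid for [y] in [g_1], this is at least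
   [dim h + 2 dim l_01], where [h] is a Cartan subalgebra contained in [g_1].  At a generic element of [h] the
   nullity is at most [dim h], hence [l_01 = 0].  The density step is done formally, with exponentials
   truncated in [F[X]].  The second claim is the first one for the pair [(sigma_1, sigma_3)]. *)

(** The square of [ad u] is what makes the count close. On [l] an element [u] of [l_1] acts through
    its component in [l_10], so it sends [l_01] into [l_11 = c], and a second application kills the
    image: all of [l_01] lies in the kernel of the square, though not necessarily in that of [ad u].
    At a generic [y] of [h] squaring costs nothing, since the whole generalised null space of [ad y]
    is [h]. Kostant-Rallis serves twice: at [y], where z_0(y) = 0 and z_1(y) = h, it gives dim g_1 -
    dim g_0 = dim h; at [x] it then reads dim l_10 + dim l_11 - dim l_00 = dim h + dim l_01. The
    second copy of dim l_01 comes from the kernel of the square. The obstacle is density over a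
    field without topology. A rank bound is the vanishing of minors, which are polynomials along the
    line from [x] to a point of [g_1]; it is enough that they vanish to every order at [x]. For a
    fixed order, exponentials of the non-nilpotent [ad z] are needed only modulo a power of the
    variable, and no group has to be constructed. *)

Lemma diagonalizable_mxE (F : fieldType) m (B : 'M[F]_m) : diagonalizable_mx B <-> diagonalizable B.
Proof.
by split=> -[P Pu dP]; exists P => //; move: dP; rewrite [X in _ -> X]/is_true
   ?/(similar_diag _ _) /= conjumx.
Qed.

(** * Spectral calculus *)

Section SpectralCalculus.
Variables (F : closedFieldType) (n : nat).
Implicit Types (A S : 'M[F]_n.+1) (v : 'rV[F]_n.+1).

Lemma coprimep_factor (p : {poly F}) a : p != 0 -> root p a ->
  exists k q, [/\ p = q * ('X - a%:P) ^+ k, (size q < size p)%N &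
    coprimep q (('X - a%:P) ^+ k)].
Proof.
move=> p0 pa; have [k [q]] := multiplicity_XsubC p a; rewrite p0 /= => qa Dp.
have q0 : q != 0 by apply: contraNneq p0 => q0; rewrite Dp q0 mul0r.
exists k, q; split=> //; last by rewrite coprimep_expr // coprimep_XsubC.
case: k Dp => [|k] Dp; first by move: qa; rewrite -[q]mulr1 -Dp pa.
by rewrite Dp size_Mmonic ?monicXn ?rpredX ?monicXsubC // size_exp_XsubC addnS /= addnS ltnS leq_addr.
Qed.

(* Bezout splits a vector killed by a polynomial in [A] along the coprime factors of that polynomial. *)
Lemma gen_eigen_ind A v (P : 'rV[F]_n.+1 -> Prop) :
    (forall u w, P u -> P w -> P (u + w)) ->
    (forall p la k, v *m horner_mx A p *m (A - la%:M) ^+ k = 0 ->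
       P (v *m horner_mx A p)) ->
  P v.
Proof.
move=> PD Pg; pose h p := v *m horner_mx A p.
have hM p q : h (p * q) = h p *m horner_mx A q by rewrite /h rmorphM /= mulmxA.
have hX p la k : h p *m (A - la%:M) ^+ k = h (p * ('X - la%:P) ^+ k).
  by rewrite hM rmorphXn /= rmorphB /= horner_mx_X horner_mx_C.
suff : forall N (p q : {poly F}), (size p <= N)%N -> p != 0 -> h (q * p) = 0 -> P (h q).
  move/(_ (size (char_poly A)) (char_poly A) 1).
  rewrite /h mul1r Cayley_Hamilton rmorph1 mulmx1 mulmx0; apply=> //.
  by rewrite monic_neq0 // char_poly_monic.
elim=> [p q|N IH p q]; first by rewrite leqn0 size_poly_eq0 => /eqP->; rewrite eqxx.
move=> sp p0 hp0; have [sp1|/closed_rootP[a pa]] := eqVneq (size p) 1%N.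
  move/eqP/size_poly1P: sp1 => [c c0 Dp]; apply: (Pg q 0 0%N).
  move/eqP: hp0; rewrite Dp hM horner_mx_C mul_mx_scalar scaler_eq0 (negPf c0).
  by move=> /eqP; rewrite /h => ->; rewrite mul0mx.
have [k [r [Dp sr co]]] := coprimep_factor p0 pa.
have r0 : r != 0 by apply: contraNneq p0 => r0; rewrite Dp r0 mul0r.
have [[s t]] := Bezout_eq1_coprimepP _ _ co; rewrite /= => Dst.
have -> : h q = h (q * (t * ('X - a%:P) ^+ k)) + h (q * (s * r)).
  by rewrite /h -mulmxDr -rmorphD /= -mulrDr addrC Dst mulr1.
apply: PD.
  apply: (IH r) => //; first by rewrite -ltnS (leq_trans sr).
  have -> : q * (t * ('X - a%:P) ^+ k) * r = q * p * t by rewrite Dp; ring.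
  by rewrite hM hp0 mul0mx.
apply: (Pg _ a k); rewrite -/(h _) hX.
have -> : q * (s * r) * ('X - a%:P) ^+ k = q * p * s by rewrite Dp; ring.
by rewrite hM hp0 mul0mx.
Qed.

(** Generalised eigenvectors of [A] span the space, so identities between matrices are checked on
    them; Jordan parts and spectral projectors are handled this way throughout. *)
Lemma gen_eigen_mx A (B C : 'M[F]_n.+1) :
    (forall v la k, v *m (A - la%:M) ^+ k = 0 -> v *m B = v *m C) -> B = C.
Proof.
move=> H; apply/row_matrixP=> i; rewrite !rowE.
apply: (@gen_eigen_ind A (delta_mx 0 i) (fun v => v *m B = v *m C)) => [u w Hu Hw|p la k /H//].
by rewrite !mulmxDl Hu Hw.
Qed.

Lemma gen_eigen_nonroot A v la k :
  ~~ root (char_poly A) la -> v *m (A - la%:M) ^+ k = 0 -> v = 0.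
Proof.
rewrite -eigenvalue_root_char /eigenvalue /eigenspace negbK kermx_eq0 row_free_unit => U.
have Uk : (A - la%:M) ^+ k \in unitmx by have := unitrX k U.
by move=> H; rewrite -[v](mulmxK Uk) H mul0mx.
Qed.

(** Chinese remainder theorem, one node at a time: the Bezout term [t * q] is 1 modulo the power at
    [a] and 0 modulo the powers at the other nodes, so adding its multiple by [phi a - p] corrects
    [p] at [a] only. *)
Lemma interpolation (phi : F -> F) (m : nat) (rs : seq F) : uniq rs ->
  exists p : {poly F}, forall la, la \in rs -> ('X - la%:P) ^+ m %| p - (phi la)%:P.
Proof.
elim: rs => [|a rs IH] /=; first by exists 0.
case/andP=> ars /IH[p Hp]; pose q := \prod_(b <- rs) ('X - b%:P) ^+ m.
have co : coprimep (('X - a%:P) ^+ m) q.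
  rewrite /q; elim: rs ars {IH Hp q} => [|b rs IH]; first by rewrite big_nil coprimep1.
  rewrite inE negb_or big_cons coprimepMr => /andP[ab /IH->]; rewrite andbT.
  rewrite coprimep_expl // coprimep_expr // coprimep_XsubC root_XsubC eq_sym //.
have [[s t]] := Bezout_eq1_coprimepP _ _ co; rewrite /= => Dst.
exists (p + t * q * ((phi a)%:P - p)) => la; rewrite inE => /predU1P[->|lars].
  have -> : p + t * q * ((phi a)%:P - p) - (phi a)%:P
     = s * (p - (phi a)%:P) * ('X - a%:P) ^+ m.
    have -> : t * q = 1 - s * ('X - a%:P) ^+ m by rewrite -Dst; ring.
    by ring.
  exact: dvdp_mull.
rewrite addrAC; apply: dvdp_add; first exact: Hp.
rewrite -mulrA dvdp_mull // dvdp_mulr // /q.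
by rewrite (big_rem la) //= dvdp_mulr.
Qed.

(** The multiplicity [j] of [la] in the characteristic polynomial is at most the dimension; Bezout
    between the cofactor and the power [k], with Cayley-Hamilton, lowers the exponent to [j]. This
    gives one exponent valid for all eigenvalues. *)
Lemma gen_eigen_bound A v la k :
  v *m (A - la%:M) ^+ k = 0 -> v *m (A - la%:M) ^+ n.+1 = 0.
Proof.
move=> Hv; have [->|Hne] := eqVneq v 0; first by rewrite mul0mx.
have ra : root (char_poly A) la.
  by apply: contraNT Hne => ra; rewrite (gen_eigen_nonroot ra Hv).
have chi0 : char_poly A != 0 by rewrite monic_neq0 // char_poly_monic.
have [j [q [Dq sq co]]] := coprimep_factor chi0 ra.
have jn : (j <= n.+1)%N.
  have := size_char_poly A; rewrite Dq size_Mmonic ?monicXn ?rpredX ?monicXsubC //.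
    have : (0 < size q)%N by rewrite size_poly_gt0; apply: contraNneq chi0 => q0; rewrite Dq q0 mul0r.
    by rewrite size_exp_XsubC addnS /=; lia.
  by apply: contraNneq chi0 => q0; rewrite Dq q0 mul0r.
have hX i : (A - la%:M) ^+ i = horner_mx A (('X - la%:P) ^+ i).
  by rewrite rmorphXn /= rmorphB /= horner_mx_X horner_mx_C.
have co' : coprimep q (('X - la%:P) ^+ k).
  case: j Dq co {jn} => [|j] Dq co; last by rewrite coprimep_expr // -(coprimep_pexpr _ _ (ltn0Sn j)).
  by move: sq; rewrite Dq expr0 mulr1 ltnn.
have [[s t]] := Bezout_eq1_coprimepP _ _ co'; rewrite /= => Dst.
suff Hj : v *m (A - la%:M) ^+ j = 0.
  have -> : (A - la%:M) ^+ n.+1 = (A - la%:M) ^+ j * (A - la%:M) ^+ (n.+1 - j) by rewrite -exprD subnKC.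
  by rewrite -mulmxE mulmxA Hj mul0mx.
have -> : (A - la%:M) ^+ j = horner_mx A (char_poly A * s)
   + (A - la%:M) ^+ k * horner_mx A (t * ('X - la%:P) ^+ j).
  rewrite !hX -rmorphM -rmorphD /= Dq; congr horner_mx.
  by rewrite -[LHS]mul1r -Dst; ring.
by rewrite rmorphM /= Cayley_Hamilton mul0r add0r -mulmxE mulmxA Hv mul0mx.
Qed.

(** Functional calculus that ignores nilpotent parts. An indicator function gives a spectral
    projector, the identity gives the semisimple Jordan part, an additive function gives a
    replica. *)
Lemma spectral_poly A (phi : F -> F) :
  exists p, forall v la k, v *m (A - la%:M) ^+ k = 0 ->
    v *m horner_mx A p = phi la *: v.
Proof.
have [rs Drs] := closed_field_poly_normal (char_poly A).
have [p Hp] := interpolation phi n.+1 (undup_uniq rs).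
exists p => v la k Hk; have Hv := gen_eigen_bound Hk; have [ra|ra] := boolP (root (char_poly A) la); last first.
  by rewrite (gen_eigen_nonroot ra Hv) mul0mx scaler0.
have lars : la \in undup rs.
  rewrite mem_undup; move: ra; rewrite Drs (monicP (char_poly_monic A)) scale1r.
  by rewrite root_prod_XsubC.
have /dvdpP[q Dq] := Hp la lars.
rewrite -[p](subrK (phi la)%:P) Dq [q * _]mulrC rmorphD rmorphM /= horner_mx_C.
rewrite mulmxDr mul_mx_scalar rmorphXn rmorphB /= horner_mx_X horner_mx_C.
by rewrite -!mulmxE !mulmxA Hv !mul0mx add0r.
Qed.

Lemma diagonalizable_of_gen_eigen A S (phi : F -> F) :
    (forall v la k, v *m (A - la%:M) ^+ k = 0 -> v *m S = phi la *: v) ->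
  diagonalizable_mx S.
Proof.
move=> HS; have [rs Drs] := closed_field_poly_normal (char_poly A).
suff [P Pu dP] : diagonalizable S by exists P; rewrite // -conjumx.
apply/diagonalizablePeigen; exists (undup (map phi rs)); first exact: undup_uniq.
apply/eqmxP; rewrite submx1 /=; apply/row_subP=> i.
apply: (@gen_eigen_ind A _ (fun v => v <= \sum_(r <- undup (map phi rs)) eigenspace S r)%MS).
  by move=> u w; apply: addmx_sub.
move=> p la k Hv; set v := _ *m horner_mx A p in Hv *.
have [ra|ra] := boolP (root (char_poly A) la); last first.
  by rewrite (gen_eigen_nonroot ra Hv) sub0mx.
have lars : phi la \in undup (map phi rs).
  rewrite mem_undup map_f //; move: ra; rewrite Drs (monicP (char_poly_monic A)) scale1r.
  by rewrite root_prod_XsubC.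
rewrite (big_rem _ lars) /=; apply: submx_trans (addsmxSl _ _).
by apply/eigenspaceP; apply: HS Hv.
Qed.

End SpectralCalculus.

Section Diagonalizable.
Variables (F : fieldType) (n : nat).
Implicit Types (A B : 'M[F]_n.+1) (v : 'rV[F]_n.+1).

Lemma diagonalizable_mx_gen_ker A v k :
  diagonalizable_mx A -> v *m A ^+ k = 0 -> v *m A = 0.
Proof.
case=> P Pu /diag_mxP[d Dd].
have DA : A = invmx P *m diag_mx d *m P by rewrite -Dd !mulmxA mulVmx // mul1mx mulmxKV.
have DAk j : A ^+ j = invmx P *m diag_mx (\row_i d 0 i ^+ j) *m P.
  elim: j => [|j IH].
    have -> : diag_mx (\row_i d 0 i ^+ 0) = 1%:M.
      by apply/matrixP=> a b; rewrite !mxE expr0.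
    by rewrite mulmx1 mulVmx.
  rewrite exprSr IH -mulmxE {1}DA !mulmxA mulmxK // -!(mulmxA _ (diag_mx _)).
  rewrite (mulmxA (diag_mx _)) mulmx_diag; congr (_ *m (diag_mx _ *m _)).
  by apply/rowP=> a; rewrite !mxE exprSr.
rewrite DAk DA !mulmxA => /(congr1 (mulmx^~ (invmx P))); rewrite mulmxK // mul0mx => H.
suff -> : v *m invmx P *m diag_mx d = 0 by rewrite mul0mx.
apply/rowP=> i; move/rowP/(_ i): H.
rewrite !mul_mx_diag !mxE => /eqP; rewrite mulf_eq0 expf_eq0.
by case/orP=> [/eqP->|/andP[_ /eqP->]]; rewrite ?mul0r ?mulr0.
Qed.

Lemma diagonalizable_mxD_comm A B a :
    diagonalizable_mx A -> diagonalizable_mx B -> A *m B = B *m A ->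
  diagonalizable_mx (A + a *: B).
Proof.
move=> /diagonalizable_mxE dA /diagonalizable_mxE dB cAB; case: (@codiagonalizableP F n.+1 [:: A; B]) => + _.
case=> [|P Pu].
  split=> [f g|f].
    by rewrite !inE => /orP[]/eqP-> /orP[]/eqP->; rewrite /comm_mx.
  by rewrite !inE => /orP[]/eqP->.
rewrite /= andbT => /andP[]; rewrite !/(similar_diag _ _) /= !conjumx //.
move=> /diag_mxP[d Dd] /diag_mxP[e De]; exists P => //.
rewrite mulmxDr mulmxDl -scalemxAr -scalemxAl Dd De -linearZ -linearD.
exact: diag_mx_is_diag.
Qed.

End Diagonalizable.

(** * Rational relations between eigenvalues *)

Section RationalEmbedding.
Variable F : fieldType.
Hypothesis charF : [pchar F] =i pred0.

Lemma intr_eq0_pchar0 (z : int) : (z%:~R == 0 :> F) = (z == 0).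
Proof.
case: z => z; first by rewrite -pmulrn (proj1 (pcharf0P F) charF).
by rewrite NegzE mulrNz oppr_eq0 -pmulrn (proj1 (pcharf0P F) charF) ?oppr_eq0.
Qed.

Lemma ratr_fracE (a b : int) : b != 0 ->
  ratr (a%:~R / b%:~R) = a%:~R / b%:~R :> F.
Proof.
move=> b0; set x : rat := _ / _.
have Hx : numq x * b = a * denq x.
  apply: (@intr_inj rat); rewrite !rmorphM /= numqE /x.
  by field; rewrite intr_eq0.
apply/eqP; rewrite /ratr eqr_div ?intr_eq0_pchar0 ?denq_eq0 //.
by rewrite -!rmorphM /= Hx.
Qed.

(** Characteristic zero keeps denominators nonzero in [F]. The morphism structure allows rational
    matrices, and their kernels, to be carried to [F]. *)
Lemma rat_embedding : exists f : {rmorphism rat -> F}, f =1 @ratr F.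
Proof.
have E x : x = (numq x)%:~R / (denq x)%:~R :> rat by rewrite divq_num_den.
have D0 x : (denq x)%:~R != 0 :> rat by rewrite intr_eq0 denq_eq0.
have D0F x : (denq x)%:~R != 0 :> F by rewrite intr_eq0_pchar0 denq_eq0.
have B : zmod_morphism (@ratr F).
  move=> x y; have -> : x - y = (numq x * denq y - numq y * denq x)%:~R
     / (denq x * denq y)%:~R.
    rewrite {1}[x]E {1}[y]E rmorphB !rmorphM /=; field; by rewrite !D0.
  rewrite ratr_fracE ?mulf_neq0 ?denq_eq0 // rmorphB !rmorphM /= /ratr.
  by field; rewrite !D0F.
have M : monoid_morphism (@ratr F).
  split=> [|x y]; first by rewrite -[1]/(1%:~R) ratr_int.
  have -> : x * y = (numq x * numq y)%:~R / (denq x * denq y)%:~R.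
    rewrite {1}[x]E {1}[y]E !rmorphM /=; field; by rewrite !D0.
  rewrite ratr_fracE ?mulf_neq0 ?denq_eq0 // !rmorphM /= /ratr.
  by field; rewrite !D0F.
pose B' := GRing.isZmodMorphism.Build rat F (@ratr F) B.
pose M' := GRing.isMonoidMorphism.Build rat F (@ratr F) M.
pose f : {rmorphism rat -> F} := HB.pack (@ratr F) B' M'.
by exists f.
Qed.

(* The relations [lam i + lam j = lam l] have rational coefficients, so [lam] is a combination of
   their rational solutions, and a positive definite rational form detects whether it vanishes. *)
Lemma rational_solution_test k (lam : 'I_k -> F) (m : 'I_k -> nat) :
    (forall i, 0 < m i)%N ->
    (forall q : 'I_k -> rat,
       (forall i j l, lam i + lam j = lam l -> q i + q j = q l) ->
       \sum_i lam i * ratr (q i) * (m i)%:R = 0) ->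
  forall i, lam i = 0.
Proof.
move=> m0 H; have [f Ef] := rat_embedding.
pose T := ('I_k * 'I_k * 'I_k)%type.
pose R : 'M[rat]_(k, #|{: T}|) := \matrix_(a, t) let: (i, j, l) := enum_val t in
  if lam i + lam j == lam l then (a == i)%:R + (a == j)%:R - (a == l)%:R else 0.
pose v : 'rV[F]_k := \row_i lam i.
have sum1 (G : fieldType) (g : 'I_k -> G) i : \sum_a g a * (a == i)%:R = g i.
  rewrite (bigD1 i) //= eqxx mulr1 big1 ?addr0 // => a /negPf->.
  by rewrite mulr0.
(* Each column of [R] encodes one additive relation, and is zero for a triple that satisfies none.
   Kernels commute with extension of scalars, so [v] is an [F]-combination of rational solutions. *)
have vR : (v <= map_mx f (kermx R))%MS.
  rewrite map_kermx; apply/sub_kermxP/rowP=> t; rewrite !mxE.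
  case Et: (enum_val t) => [[i j] l]; have [e|ne] := eqVneq (lam i + lam j) (lam l).
    under eq_bigr => a _ do rewrite !mxE Et e eqxx rmorphB rmorphD !rmorph_nat mulrBr mulrDr.
    by rewrite sumrB big_split /= !sum1 e subrr.
  by rewrite big1 // => a _; rewrite !mxE Et (negPf ne) rmorph0 mulr0.
have [K KR vK] : exists2 K : 'M_k, K *m R = 0 & (v <= map_mx f K)%MS.
  by exists (kermx R); first exact: mulmx_ker.
have Krel b i j l : lam i + lam j = lam l -> K b i + K b j = K b l.
  move=> e; move/matrixP: KR => /(_ b (enum_rank (i, j, l))).
  rewrite !mxE; under eq_bigr => a _ do rewrite !mxE enum_rankK e eqxx mulrBr mulrDr.
  by rewrite sumrB big_split /= !sum1 => /eqP; rewrite subr_eq0 => /eqP.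
pose D : 'M[rat]_k := diag_mx (\row_i (m i)%:R).
have DK i b : (D *m K^T) i b = (m i)%:R * K b i by rewrite mul_diag_mx !mxE.
have uD (w : 'rV_k) i : (w *m D) 0 i = w 0 i * (m i)%:R by rewrite mul_mx_diag !mxE.
have KD0 : v *m map_mx f (D *m K^T) = 0.
  apply/rowP=> b; rewrite !mxE -[RHS](H (K b)) => [|i j l]; last exact: Krel.
  apply: eq_bigr => i _; rewrite [in LHS]mxE [map_mx _ _ _ _]mxE DK rmorphM rmorph_nat /= Ef.
  by rewrite -mulrA [in LHS](mulrC _%:R).
have [c Dc] := submxP vK.
(* Positivity is used over the rationals, where a weighted sum of squares vanishes only termwise;
   over [F] such sums may cancel. The inclusion of kernels then survives the passage to [F]. *)
have kerK : (kermx (K *m D *m K^T) <= kermx K)%MS.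
  apply/rV_subP=> u /sub_kermxP Hu; apply/sub_kermxP.
  have Q : \sum_i (u *m K) 0 i ^+ 2 * (m i)%:R = 0.
    have : (u *m (K *m D *m K^T) *m u^T) 0 0 = 0 by rewrite Hu mul0mx mxE.
    rewrite !mulmxA -(mulmxA _ K^T) -trmx_mul mxE => E; rewrite -[RHS]E.
    by apply: eq_bigr => i _; rewrite uD [(_^T)%R _ _]mxE expr2 mulrAC.
  apply/rowP=> i; rewrite [RHS]mxE; apply/eqP.
  have /eqP := Q; rewrite psumr_eq0 => [/allP/(_ i)|j _]; last first.
    by rewrite mulr_ge0 ?sqr_ge0 ?ler0n.
  rewrite mem_index_enum => /(_ isT)/=; rewrite mulf_eq0 pnatr_eq0 expf_eq0 /=.
  by case/orP=> // /eqP mi; move: (m0 i); rewrite mi.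
have : (c <= map_mx f (kermx K))%MS.
  apply: submx_trans (_ : c <= map_mx f (kermx (K *m D *m K^T)))%MS _.
    rewrite map_kermx; apply/sub_kermxP.
    by rewrite -mulmxA map_mxM mulmxA -Dc.
  by rewrite map_submx.
rewrite map_kermx => /sub_kermxP cK i.
by move/rowP: Dc => /(_ i); rewrite cK !mxE.
Qed.

End RationalEmbedding.

(** In the rank factorization [e = c *m r], idempotence forces [r *m c = 1], and the trace of
    [c *m r] equals that of this identity matrix. *)
Lemma mxtrace_idempotent (F : fieldType) n (e : 'M[F]_n) :
  e *m e = e -> \tr e = (\rank e)%:R.
Proof.
move=> ee; set c := col_base e; set r := row_base e; have De : c *m r = e := mulmx_base e.
rewrite -{1}De mxtrace_mulC.
suff -> : r *m c = 1%:M by rewrite mxtrace1.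
have [B rB] := row_freeP (row_base_free e); have [C Cc] := row_fullP (col_base_full e).
have {}rB : r *m B = 1%:M := rB; have {}Cc : C *m c = 1%:M := Cc.
clearbody c r.
have : C *m (c *m r *m (c *m r)) *m B = C *m (c *m r) *m B by rewrite De ee.
by rewrite !mulmxA Cc !mul1mx -!mulmxA rB !mulmx1.
Qed.

(** * Nilpotency detected by traces against replicas *)

Section TraceTest.
Variables (F : closedFieldType) (n : nat).
Implicit Types (A N : 'M[F]_n.+1) (v : 'rV[F]_n.+1).

Lemma char_poly_nilpotent A :
  (forall la, eigenvalue A la -> la = 0) -> char_poly A = 'X^(n.+1).
Proof.
move=> H; have [rs] := closed_field_poly_normal (char_poly A).
rewrite (monicP (char_poly_monic A)) scale1r => Drs.
have r0 : {in rs, forall r, r = 0}.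
  by move=> r rrs; apply: H; rewrite eigenvalue_root_char Drs root_prod_XsubC.
have Dx : char_poly A = 'X^(size rs).
  rewrite Drs; elim: rs r0 {Drs} => [|r rs IH] r0; first by rewrite big_nil expr0.
  rewrite big_cons IH; last by move=> s srs; apply: r0; rewrite inE srs orbT.
  by rewrite (r0 r) ?mem_head // subr0 exprS.
by have := size_char_poly A; rewrite Dx size_polyXn => -[->].
Qed.

Lemma nilpotent_eigenvalue0 A :
  (forall la, eigenvalue A la -> la = 0) -> A ^+ n.+1 = 0.
Proof.
move=> /char_poly_nilpotent E; have := Cayley_Hamilton A.
by rewrite E rmorphXn /= horner_mx_X.
Qed.

Lemma mxtrace_nilpotent N k : N ^+ k = 0 -> \tr N = 0.
Proof.
move=> Nk; have E : char_poly N = 'X^(n.+1).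
  apply: char_poly_nilpotent => la /eigenvalueP[v vN v0].
  have Hk j : v *m N ^+ j = la ^+ j *: v.
    elim: j => [|j IH]; first by rewrite expr0 mulmx1 scale1r.
    by rewrite exprSr -mulmxE mulmxA IH -scalemxAl vN scalerA exprSr.
  move/eqP: (Hk k); rewrite Nk mulmx0 eq_sym scaler_eq0 (negPf v0) orbF.
  by rewrite expf_eq0 => /andP[_ /eqP].
apply/eqP; rewrite -oppr_eq0 -char_poly_trace // E coefXn /=.
by rewrite (ltn_eqF (ltnSn n)).
Qed.

(** Core of Cartan's criterion. A rational solution [q] of the relations between eigenvalues defines
    an additive [phi], and the trace condition becomes the vanishing of the sum of the [lam i * q i]
    weighted by multiplicities, so [rational_solution_test] applies. Only additive [phi] are allowed
    because the replica of a derivation must again be a derivation. *)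
Lemma nilpotent_trace_test A : [pchar F] =i pred0 ->
    (forall phi p,
       (forall a b, eigenvalue A a -> eigenvalue A b -> eigenvalue A (a + b) ->
          phi (a + b) = phi a + phi b) ->
       (forall v la k, v *m (A - la%:M) ^+ k = 0 -> v *m horner_mx A p = phi la *: v) ->
       \tr (A *m horner_mx A p) = 0) ->
  A ^+ n.+1 = 0.
Proof.
move=> charF H; apply: nilpotent_eigenvalue0.
have [rs0 Drs] := closed_field_poly_normal (char_poly A).
pose rs := undup rs0; pose lam (i : 'I_(size rs)) := rs`_i.
have inrs a : eigenvalue A a = (a \in rs).
  rewrite eigenvalue_root_char Drs (monicP (char_poly_monic A)) scale1r.
  by rewrite root_prod_XsubC mem_undup.
have lam_inj : injective lam.
  by move=> i j /eqP; rewrite nth_uniq ?undup_uniq // => /eqP/val_inj.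
have lamE a : eigenvalue A a -> exists i, a = lam i.
  rewrite inrs => ars; have ai : (index a rs < size rs)%N by rewrite index_mem.
  by exists (Ordinal ai); rewrite /lam nth_index.
have eigl i : eigenvalue A (lam i) by rewrite inrs mem_nth.
have [e He] := fin_all_exists (fun i => spectral_poly A (fun la => (la == lam i)%:R)).
pose E i := horner_mx A (e i).
have EE i : E i *m E i = E i.
  apply: (@gen_eigen_mx _ _ A) => v la k /(He i) Hv.
  by rewrite mulmxA Hv -scalemxAl Hv; case: eqP; rewrite ?scale1r ?scale0r.
(* [A - lam i] is nilpotent on the image of the projector [E i], hence contributes no trace
   there. *)
have trAE i : \tr (A *m E i) = lam i * (\rank (E i))%:R.
  rewrite -(mxtrace_idempotent (EE i)) -mxtraceZ; apply/eqP; rewrite -subr_eq0 -linearB /=.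
  apply/eqP/(@mxtrace_nilpotent _ n.+1); rewrite -mul_scalar_mx -mulmxBl.
  have C : GRing.comm (A - (lam i)%:M) (E i).
    by apply: comm_mx_horner; apply: comm_mx_sym; apply: comm_mxB; [exact: comm_mx_refl | exact: comm_mx_scalar].
  rewrite exprMn_comm //; apply: (@gen_eigen_mx _ _ A) => v la k Hk.
  rewrite mulmx0 (commrX _ (commr_sym (commrX _ (commr_sym C)))) -mulmxE mulmxA.
  have -> j : v *m E i ^+ j.+1 = (la == lam i)%:R *: v.
    elim: j => [|j IH]; first by rewrite expr1 (He i _ _ _ Hk).
    by rewrite exprSr -mulmxE mulmxA IH -scalemxAl (He i _ _ _ Hk); case: eqP; rewrite ?scale1r ?scale0r.
  by case: eqP => [<-|_]; rewrite ?scale0r ?mul0mx // scale1r (gen_eigen_bound Hk).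
have rk i : (0 < \rank (E i))%N.
  rewrite lt0n mxrank_eq0; apply/eqP => E0.
  case/eigenvalueP: (eigl i) => v vA /eqP; apply.
  have := He i v (lam i) 1%N; rewrite -/(E i) E0 mulmx0 eqxx scale1r => <- //.
  by rewrite expr1 mulmxBr vA mul_mx_scalar subrr.
move=> la /lamE[i0 ->]; move: i0; apply: (rational_solution_test charF rk) => q Hq.
pose phi a : F := \sum_i (a == lam i)%:R * ratr (q i).
have phil i : phi (lam i) = ratr (q i).
  rewrite /phi (bigD1 i) //= eqxx mul1r big1 ?addr0 // => j /negPf ji.
  by rewrite (inj_eq lam_inj) eq_sym ji mul0r.
have [f Ef] := rat_embedding charF.
rewrite -[RHS](H phi (\sum_i ratr (q i) *: e i)).
- rewrite rmorph_sum /= mulmx_sumr linear_sum /=; apply: eq_bigr => i _.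
  by rewrite linearZ /= -scalemxAr mxtraceZ -/(E i) trAE [RHS]mulrCA mulrA.
- move=> a b /lamE[i ->] /lamE[j ->] /lamE[l El]; rewrite El !phil.
  by rewrite -(Hq i j l) // -!Ef rmorphD.
move=> v a k Hk; rewrite rmorph_sum /= mulmx_sumr /phi scaler_suml; apply: eq_bigr => i _.
by rewrite linearZ /= -scalemxAr (He i _ _ _ Hk) scalerA mulrC.
Qed.

End TraceTest.

(** * Lie algebras, Engel's theorem and the Killing form *)

Section KernelSubspace.
Variables (F : fieldType) (n : nat).

Lemma row_lin1_mx m (f : 'rV[F]_n -> 'rV[F]_m) v :
  (forall a x y, f (a *: x + y) = a *: f x + f y) -> v *m lin1_mx f = f v.
Proof.
move=> lf.
pose g : {linear 'rV[F]_n -> 'rV[F]_m} := HB.pack f (GRing.isLinear.Build F _ _ *:%R f lf).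
exact: (mul_rV_lin1 g v).
Qed.

Lemma linear_kernel_exists m p (f : 'rV[F]_n -> 'M[F]_(m, p)) :
    (forall a x y, f (a *: x + y) = a *: f x + f y) ->
  exists U : 'M[F]_n, forall x : 'rV_n, (x <= U)%MS <-> f x = 0.
Proof.
move=> lf; exists (kermx (lin1_mx (fun x => mxvec (f x)))) => x.
have E : x *m lin1_mx (fun x => mxvec (f x)) = mxvec (f x).
  by apply: row_lin1_mx => a u w; rewrite lf linearP.
split=> [/sub_kermxP|fx0]; first by rewrite E => /eqP; rewrite mxvec_eq0 => /eqP.
by apply/sub_kermxP; rewrite E fx0 linear0.
Qed.

Lemma linear_form_ext (f g : 'rV[F]_n -> F) :
    (forall a x y, f (a *: x + y) = a * f x + f y) ->
    (forall a x y, g (a *: x + y) = a * g x + g y) ->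
    (forall j, f (delta_mx 0 j) = g (delta_mx 0 j)) ->
  f =1 g.
Proof.
move=> lf lg fg x.
have l0 (h : 'rV[F]_n -> F) : (forall a x y, h (a *: x + y) = a * h x + h y) -> h 0 = 0.
  by move=> lh; have := lh 1 0 0; rewrite scaler0 addr0 mul1r => /eqP; rewrite -subr_eq subrr => /eqP.
rewrite [x]row_sum_delta; elim/big_rec: _ => [|j y _ IH]; first by rewrite !l0.
by rewrite lf lg fg IH.
Qed.

Lemma sub_adds_rVP m (v x : 'rV[F]_n) (K : 'M[F]_(m, n)) :
  (v <= K + x)%MS -> exists k a, (k <= K)%MS /\ v = k + a *: x.
Proof.
case/sub_addsmxP=> -[a b] ->; exists (a *m K), (b 0 0); split; first exact: submxMl.
by rewrite /= [b in LHS]mx11_scalar mul_scalar_mx.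
Qed.

Lemma sub0P (v : 'rV[F]_n) : (v <= (0 : 'M_n))%MS -> v = 0.
Proof. by rewrite submx0 => /eqP. Qed.

End KernelSubspace.

Section LieAlgebra.
Variables (F : closedFieldType) (n : nat).
Local Notation V := 'rV[F]_n.+1.
Variable br : V -> V -> V.
Hypothesis Lbr : lie_algebra br.
Local Notation ad := (ad br).
Implicit Types (x y z : V) (D : 'M[F]_n.+1).

Lemma br_linl a x y z : br (a *: x + y) z = a *: br x z + br y z.
Proof. by case: Lbr. Qed.
Lemma br_linr a x y z : br z (a *: x + y) = a *: br z x + br z y.
Proof. by case: Lbr. Qed.
Lemma brDl x y z : br (x + y) z = br x z + br y z.
Proof. by have := br_linl 1 x y z; rewrite !scale1r. Qed.
Lemma brDr x y z : br z (x + y) = br z x + br z y.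
Proof. by have := br_linr 1 x y z; rewrite !scale1r. Qed.
Lemma br0l z : br 0 z = 0.
Proof. by have := brDl 0 0 z; rewrite addr0 => /eqP; rewrite -subr_eq subrr => /eqP. Qed.
Lemma br0r z : br z 0 = 0.
Proof. by have := brDr 0 0 z; rewrite addr0 => /eqP; rewrite -subr_eq subrr => /eqP. Qed.
Lemma brZl a x z : br (a *: x) z = a *: br x z.
Proof. by have := br_linl a x 0 z; rewrite !addr0 br0l addr0. Qed.
Lemma brZr a x z : br z (a *: x) = a *: br z x.
Proof. by have := br_linr a x 0 z; rewrite !addr0 br0r addr0. Qed.
Lemma brxx x : br x x = 0.
Proof. by case: Lbr. Qed.
Lemma brC x y : br x y = - br y x.
Proof.
have := brxx (x + y); rewrite brDl !brDr !brxx add0r addr0 => /eqP.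
by rewrite addr_eq0 => /eqP.
Qed.
Lemma brNl x z : br (- x) z = - br x z.
Proof. by rewrite -scaleN1r brZl scaleN1r. Qed.
Lemma brNr x z : br z (- x) = - br z x.
Proof. by rewrite -scaleN1r brZr scaleN1r. Qed.

Lemma jacobi x y z : br x (br y z) = br (br x y) z + br y (br x z).
Proof.
case: Lbr => _ _ _ /(_ x y z); rewrite (brC z x) brNr (brC z (br x y)).
by move/eqP; rewrite -addrA -opprD subr_eq0 => /eqP->; rewrite addrC.
Qed.

Lemma adE x v : v *m ad x = br x v.
Proof. by apply: row_lin1_mx => a y z; exact: br_linr. Qed.

Lemma ad_lin a x y : ad (a *: x + y) = a *: ad x + ad y.
Proof.
by apply/row_matrixP=> i; rewrite !rowE mulmxDr -scalemxAr !adE br_linl.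
Qed.

Lemma adD x y : ad (x + y) = ad x + ad y.
Proof. by rewrite -[x]scale1r ad_lin !scale1r. Qed.

Lemma ad0 : ad 0 = 0.
Proof. by apply/row_matrixP=> i; rewrite !rowE adE br0l mulmx0. Qed.

Lemma adZ a x : ad (a *: x) = a *: ad x.
Proof. by rewrite -[a *: x]addr0 ad_lin ad0 addr0. Qed.

Lemma adN x : ad (- x) = - ad x.
Proof. by rewrite -scaleN1r adZ scaleN1r. Qed.

(** Matrices act on the right, so products compose in reverse order; this accounts for the sign of
    the commutator. *)
Lemma ad_br x y : ad (br x y) = ad y *m ad x - ad x *m ad y.
Proof.
apply/row_matrixP=> i; rewrite !rowE mulmxBr !mulmxA !adE.
by rewrite [br x (br _ _)]jacobi addrK.
Qed.

Definition derivation D := forall x y, br x y *m D = br (x *m D) y + br x (y *m D).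

Lemma ad_derivation x : derivation (ad x).
Proof. by move=> y z; rewrite !adE jacobi. Qed.

(** [D - (a + b)] applied to a bracket lands either as [D - a] on [x] or as [D - b] on [y]; each
    application lowers [j + k] by one. *)
Lemma derivation_gen_eigen D x y a b j k : derivation D ->
    x *m (D - a%:M) ^+ j = 0 -> y *m (D - b%:M) ^+ k = 0 ->
  br x y *m (D - (a + b)%:M) ^+ (j + k) = 0.
Proof.
move=> dD; move En: (j + k)%N => N.
elim: N j k x y En => [|N IH] [|j] [|k] // x y.
- by move=> _; rewrite !expr0 !mulmx1 => -> _; rewrite br0l.
- by move=> _; rewrite expr0 !mulmx1 => -> _; rewrite br0l mul0mx.
- by move=> _ _; rewrite expr0 !mulmx1 => ->; rewrite br0r mul0mx.
rewrite addSn => -[En] Hx Hy; rewrite exprS -mulmxE mulmxA.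
have -> : br x y *m (D - (a + b)%:M) = br (x *m (D - a%:M)) y + br x (y *m (D - b%:M)).
  rewrite !mulmxBr dD !mul_mx_scalar !brDl !brDr !brNl !brNr brZl brZr scalerDl.
  by rewrite opprD addrACA.
rewrite mulmxDl (IH j k.+1) ?(IH j.+1 k) ?addr0 ?addSn -?addnS //.
  by rewrite -mulmxA mulmxE -exprS.
by rewrite -mulmxA mulmxE -exprS.
Qed.

(** By bilinearity [x] and [y] may be generalised eigenvectors. A nonzero bracket then has
    eigenvalue [a + b], which is where additivity of [phi] is needed, and only there. *)
Lemma spectral_derivation D (phi : F -> F) p : derivation D ->
    (forall a b, eigenvalue D a -> eigenvalue D b -> eigenvalue D (a + b) ->
       phi (a + b) = phi a + phi b) ->
    (forall (v : V) la k, v *m (D - la%:M) ^+ k = 0 -> v *m horner_mx D p = phi la *: v) ->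
  derivation (horner_mx D p).
Proof.
move=> dD Hphi Hp x y.
have ev (v : V) la k : v *m (D - la%:M) ^+ k = 0 -> v != 0 -> eigenvalue D la.
  move=> Hv; rewrite eigenvalue_root_char; apply: contraR => /gen_eigen_nonroot H.
  by rewrite (H _ _ Hv).
set E := horner_mx D p in Hp *.
apply: (@gen_eigen_ind _ _ D x (fun x => br x y *m E = br (x *m E) y + br x (y *m E))) => [u w Hu Hw|q a j].
  by rewrite brDl !mulmxDl Hu Hw !brDl addrACA.
move: (x *m _) => {}x Hx.
apply: (@gen_eigen_ind _ _ D y (fun y => br x y *m E = br (x *m E) y + br x (y *m E))) => [u w Hu Hw|r b k].
  by rewrite brDr !mulmxDl Hu Hw !brDr addrACA.
move: (y *m _) => {}y Hy.
have Hxy := derivation_gen_eigen dD Hx Hy.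
rewrite (Hp _ _ _ Hx) (Hp _ _ _ Hy) (Hp _ _ _ Hxy) brZl brZr -scalerDl.
have [->|xy0] := eqVneq (br x y) 0; first by rewrite !scaler0.
rewrite Hphi //; last exact: ev Hxy xy0.
  by apply: ev Hx _; apply: contraNneq xy0 => ->; rewrite br0l.
by apply: ev Hy _; apply: contraNneq xy0 => ->; rewrite br0r.
Qed.

Definition killing x y : F := \tr (ad x *m ad y).

Lemma killing_linl a x y z : killing (a *: x + y) z = a * killing x z + killing y z.
Proof. by rewrite /killing ad_lin mulmxDl -scalemxAl mxtraceD mxtraceZ. Qed.

Lemma killingC x y : killing x y = killing y x.
Proof. exact: mxtrace_mulC. Qed.

Lemma killing_linr a x y z : killing z (a *: x + y) = a * killing z x + killing z y.
Proof. by rewrite !(killingC z) killing_linl. Qed.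

Lemma killing_br x y z : killing (br x y) z = killing x (br y z).
Proof.
rewrite /killing !ad_br mulmxBl mulmxBr !raddfB /= !mulmxA; congr (_ - _).
by rewrite mxtrace_mulC mulmxA mxtrace_mulC mulmxA.
Qed.

Lemma mem_brspan U W x y : (x <= U)%MS -> (y <= W)%MS -> (br x y <= brspan br U W)%MS.
Proof.
have H i j : (br (row i U) (row j W) <= brspan br U W)%MS.
  rewrite /brspan; apply: (sumsmx_sup i) => //; apply: (sumsmx_sup j) => //.
  by rewrite genmxE.
move=> /submxP[a ->] /submxP[b ->].
have bL z : (forall i, (br (row i U) z <= brspan br U W)%MS) -> (br (a *m U) z <= brspan br U W)%MS.
  move=> Hz; rewrite mulmx_sum_row.
  elim/big_ind: _ => [|u w Hu Hw|i _]; first by rewrite br0l sub0mx.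
    by rewrite brDl addmx_sub.
  by rewrite brZl scalemx_sub.
apply: bL => i; rewrite mulmx_sum_row.
elim/big_ind: _ => [|u w Hu Hw|j _]; first by rewrite br0r sub0mx.
  by rewrite brDr addmx_sub.
by rewrite brZr scalemx_sub.
Qed.

Lemma brspan_sub (U W S : 'M[F]_n.+1) :
    (forall x y, (x <= U)%MS -> (y <= W)%MS -> (br x y <= S)%MS) ->
  (brspan br U W <= S)%MS.
Proof.
move=> H; rewrite /brspan; apply/sumsmx_subP=> i _; apply/sumsmx_subP=> j _.
by rewrite genmxE H // row_sub.
Qed.

Lemma abelian_ideal0 Z : semisimple_lie br -> lie_ideal br Z ->
    (forall x y, (x <= Z)%MS -> (y <= Z)%MS -> br x y = 0) ->
  Z = 0.
Proof.
move=> ss iZ aZ; apply/eqP; rewrite -mxrank_eq0; apply/eqP/ss => //; exists 1%N => /=.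
apply/eqP; rewrite mxrank_eq0 -submx0; apply: brspan_sub => x y Zx Zy.
by rewrite aZ // sub0mx.
Qed.

(** Engel's conclusion for the action of [K] on the quotient [U / W], phrased without quotients:
    some nonzero class is killed. Quantifying over all stable pairs allows the choice [U = J],
    [W = K] inside the proof of Engel's theorem itself. *)
Definition has_engel_vectors (K : 'M[F]_n.+1) := forall U W : 'M[F]_n.+1,
  (W <= U)%MS -> ~~ (U <= W)%MS ->
  (forall k u, (k <= K)%MS -> (u <= U)%MS -> (br k u <= U)%MS) ->
  (forall k u, (k <= K)%MS -> (u <= W)%MS -> (br k u <= W)%MS) ->
  exists u : V, [/\ (u <= U)%MS, ~~ (u <= W)%MS & forall k, (k <= K)%MS -> (br k u <= W)%MS].

(** Start from a vector good for [K] and apply [ad x] repeatedly. Since [x] normalises [K], every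
    iterate stays good for [K]; the last iterate outside [W] is also sent into [W] by [x]. *)
Lemma engel_extend K x m : has_engel_vectors K -> ad x ^+ m = 0 ->
    (forall k, (k <= K)%MS -> (br k x <= K)%MS) ->
  has_engel_vectors (K + x)%MS.
Proof.
move=> eK xm Kx U W WU UW sU sW.
have Kk k : (k <= K)%MS -> (k <= K + x)%MS by move/submx_trans; apply; apply: addsmxSl.
have xx : (x <= K + x)%MS by apply: addsmxSr.
have [k w /Kk|k w /Kk|u [uU uW uK]] := eK U W WU UW; [exact: sU | exact: sW |].
pose s i := u *m ad x ^+ i.
have sS i : s i.+1 = br x (s i) by rewrite /s exprSr -mulmxE mulmxA adE.
have sP i : (s i <= U)%MS /\ forall k, (k <= K)%MS -> (br k (s i) <= W)%MS.
  elim: i => [|i [IHU IHK]]; first by rewrite /s expr0 mulmx1.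
  rewrite sS; split; first exact: sU.
  move=> k kK; rewrite jacobi addmx_sub ?IHK ?Kx //.
  by apply: sW => //; apply: IHK.
have ex : exists i, (s i <= W)%MS by exists m; rewrite /s xm mulmx0 sub0mx.
case: (ex_minnP ex) => -[|i] siW mi; first by move: siW; rewrite /s expr0 mulmx1 (negPf uW).
exists (s i); split; [exact: (sP i).1 | by apply/negP=> /mi; rewrite ltnn |].
move=> k' /sub_adds_rVP[k [a [kK ->]]]; rewrite brDl brZl addmx_sub //.
  exact: (sP i).2.
by rewrite scalemx_sub // -sS.
Qed.

(** Induction on the codimension of [K] in [J]. The property of [K], applied to the pair [J], [K],
    yields an element of [J] outside [K] that normalises [K], and [K + x] is a larger subalgebra
    with the same property. *)
Lemma engel J : subalgebra br J ->
  (forall x, (x <= J)%MS -> exists m, ad x ^+ m = 0) -> has_engel_vectors J.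
Proof.
move=> sJ nJ.
suff H d K : (\rank J <= \rank K + d)%N -> subalgebra br K -> (K <= J)%MS ->
    has_engel_vectors K -> has_engel_vectors J.
  apply: (H (\rank J) 0) => [|x y||U W WU UW _ _]; rewrite ?mxrank0 ?sub0mx //.
    by move=> /sub0P-> _; rewrite br0l sub0mx.
  have [u uU uW] : exists2 u : V, (u <= U)%MS & ~~ (u <= W)%MS.
    by case/row_subPn: UW => i Hi; exists (row i U) => //; apply: row_sub.
  by exists u; split=> // k /sub0P->; rewrite br0l sub0mx.
elim: d K => [|d IH] K rK sK KJ eK.
  have JK : (J <= K)%MS by rewrite -(geq_leqif (mxrank_leqif_sup KJ)) -[\rank K]addn0.
  move=> U W WU UW sU sW; case: (eK U W) => // [k u kK|k u kK|u [uU uW uK]].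
  - by apply: sU; apply: submx_trans KJ.
  - by apply: sW; apply: submx_trans KJ.
  - by exists u; split=> // k kJ; apply: uK; apply: submx_trans JK.
have [JK|JK] := boolP (J <= K)%MS.
  apply: (IH K) => //; by rewrite (leq_trans (mxrankS JK)) // leq_addr.
case: (eK J K) => // [k u kK|x [xJ xK xk]].
  by apply: sJ; apply: submx_trans KJ.
have [m xm] := nJ x xJ.
apply: (IH (K + x)%MS).
- apply: leq_trans rK _; rewrite addnS -addSn leq_add2r.
  rewrite ltnNge; apply: contra xK => rk.
  have := mxrank_leqif_sup (addsmxSl K x) => /geq_leqif; rewrite rk => /esym.
  by move/(submx_trans (addsmxSr K x)).
- move=> u w /sub_adds_rVP[k [a [kK ->]]] /sub_adds_rVP[l [b [lK ->]]].
  apply: submx_trans (addsmxSl K x); rewrite brDl !brDr !brZl !brZr brxx !scaler0 addr0.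
  have xl : (br x l <= K)%MS by rewrite brC -scaleN1r scalemx_sub ?xk.
  apply: addmx_sub; last exact: scalemx_sub.
  by apply: addmx_sub; [exact: sK | apply/scalemx_sub/xk].
- by rewrite addsmx_sub KJ.
- exact: engel_extend eK xm xk.
Qed.

Hypotheses (charF : [pchar F] =i pred0) (ss : semisimple_lie br).

(* Cartan's criterion: an element of the derived radical is traceless against every rational replica of its
   adjoint, hence nilpotent, and Engel's theorem then yields an abelian ideal. *)
Lemma killing_nondegenerate x : (forall y, killing x y = 0) -> x = 0.
Proof.
have [R HR] : exists R : 'M[F]_n.+1, forall x, (x <= R)%MS <-> forall y, killing x y = 0.
  have [|R HR] := @linear_kernel_exists F n.+1 1 n.+1 (fun x => \row_j killing x (delta_mx 0 j)).
    by move=> a u w; apply/rowP=> j; rewrite !mxE killing_linl.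
  exists R => u; rewrite HR; split=> [/rowP H y|H]; last by apply/rowP=> j; rewrite !mxE.
  apply: (@linear_form_ext _ _ _ (fun=> 0)) y => [a v w|a v w|j]; first exact: killing_linr.
    by rewrite mulr0 addr0.
  by have := H j; rewrite !mxE.
suff R0 : R = 0 by move/HR; rewrite R0 => /sub0P.
have iR : lie_ideal br R.
  move=> u w /HR Hw; apply/HR => y; rewrite brC -scaleN1r -[_ *: _]addr0 killing_linl killing_br Hw mulr0.
  by rewrite /killing ad0 mul0mx mxtrace0 addr0.
pose J := brspan br R R.
have JR : (J <= R)%MS by apply: brspan_sub => u w Ru Rw; apply: iR.
have iJ : lie_ideal br J.
  move=> u w Jw; have : (J <= kermx (ad u *m cokermx J))%MS.
    apply: brspan_sub => a b Ra Rb; apply/sub_kermxP/eqP; rewrite mulmxA adE -submxE.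
    by rewrite jacobi addmx_sub // mem_brspan // iR.
  by move/(submx_trans Jw)/sub_kermxP; rewrite mulmxA adE => /eqP; rewrite -submxE.
have nJ u : (u <= J)%MS -> exists m, ad u ^+ m = 0.
  move=> uJ; exists n.+1; apply: nilpotent_trace_test => // phi p Hphi Hp.
  have := spectral_derivation (ad_derivation u) Hphi Hp; set D := horner_mx _ p => dD.
  have [|S HS] := @linear_kernel_exists F n.+1 1 1 (fun y => (\tr (ad y *m D))%:M).
    move=> a v w; rewrite ad_lin mulmxDl -scalemxAl mxtraceD mxtraceZ.
    by rewrite scale_scalar_mx raddfD.
  have tr0 (c : F) : c%:M = 0 :> 'M_1 -> c = 0 by move/matrixP/(_ 0 0); rewrite !mxE.
  suff JS : (J <= S)%MS by apply: tr0; apply/HS; apply: submx_trans JS.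
  apply: brspan_sub => a b /HR Ka _; apply/HS.
  have adD : ad (b *m D) = ad b *m D - D *m ad b.
    apply/row_matrixP=> i; rewrite !rowE mulmxBr !mulmxA !adE dD.
    by rewrite addrK.
  (* As [D] is a derivation, invariance of the trace moves it onto [b]; the pairing vanishes because
     [a] lies in the radical [R] of the Killing form. *)
  suff -> : \tr (ad (br a b) *m D) = - killing a (b *m D) by rewrite Ka oppr0 raddf0.
  have trB (A B : 'M[F]_n.+1) : \tr (A - B) = \tr A - \tr B by exact: raddfB.
  rewrite ad_br /killing adD mulmxBl mulmxBr !trB opprB !mulmxA; congr (_ - _).
  by rewrite mxtrace_mulC mulmxA mxtrace_mulC mulmxA.
have J0 : J = 0.
  apply/eqP; rewrite -submx0; apply/negPn/negP => nzJ.
  have sJ : subalgebra br J by move=> u w _; apply: iJ.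
  have [k w _|k w _ /sub0P->|u [uJ uz uK]] := @engel J sJ nJ J 0 (sub0mx _ _) nzJ.
  - exact: iJ.
  - by rewrite br0r sub0mx.
  (* [S] is the centralizer of [J]. The Engel vector lies in [J :&: S], the centre of [J], which is
     an abelian ideal and therefore zero. *)
  have [|S HS] := @linear_kernel_exists F n.+1 n.+1 n.+1 (fun y => J *m ad y).
    by move=> a v w; rewrite ad_lin mulmxDr scalemxAr.
  have HSJ v : (v <= S)%MS <-> forall k, (k <= J)%MS -> br k v = 0.
    rewrite HS; split=> [Jv k /submxP[a ->]|H].
      by rewrite brC -adE -mulmxA Jv mulmx0 oppr0.
    by apply/row_matrixP=> i; rewrite row_mul adE brC H ?row_sub // oppr0 row0.
  suff Z0 : (J :&: S)%MS = 0.
    by case/negP: uz; rewrite -Z0 sub_capmx uJ; apply/HSJ => k /uK/sub0P.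
  apply: (abelian_ideal0 ss) => v w.
    rewrite !sub_capmx => /andP[wJ /HSJ wS]; rewrite iJ //=; apply/HSJ => k kJ.
    by rewrite jacobi !wS ?br0r ?addr0 // brC -scaleN1r scalemx_sub // iJ.
  by rewrite !sub_capmx => /andP[vJ _] /andP[_ /HSJ]; apply.
apply: (abelian_ideal0 ss iR) => u w Ru Rw; apply: sub0P.
by rewrite -J0 mem_brspan.
Qed.

(** Nondegeneracy represents the form y -> tr(ad y D) by some [d]. The difference [E = D - ad d] is
    a derivation traceless against every [ad y]; the Killing pairing of [a *m E] with [b] is the
    trace of [ad (br a b) *m E], so [E = 0]. *)
Lemma derivation_inner D : derivation D -> exists d, D = ad d.
Proof.
move=> dD; pose K := lin1_mx (fun x => \row_j killing x (delta_mx 0 j)).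
have KE x : x *m K = \row_j killing x (delta_mx 0 j).
  by apply: row_lin1_mx => a u w; apply/rowP=> j; rewrite !mxE killing_linl.
have Ku : K \in unitmx.
  rewrite -row_free_unit -kermx_eq0; apply/rowV0P=> x /sub_kermxP; rewrite KE => /rowP Hx.
  apply: killing_nondegenerate; apply: linear_form_ext => [a v w|a v w|j].
  - exact: killing_linr.
  - by rewrite mulr0 addr0.
  - by have := Hx j; rewrite !mxE.
pose d := (\row_j \tr (ad (delta_mx 0 j) *m D)) *m invmx K.
have Hd y : killing d y = \tr (ad y *m D).
  apply: (@linear_form_ext _ _ _ (fun y => \tr (ad y *m D))) y => [a v w|a v w|j].
  - exact: killing_linr.
  - by rewrite ad_lin mulmxDl -scalemxAl mxtraceD mxtraceZ.
  by have := KE d; rewrite /d mulmxKV // => /rowP/(_ j); rewrite !mxE.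
exists d; have [E DE] : exists E, E = D - ad d by exists (D - ad d).
have dE : derivation E.
  move=> x y; rewrite DE !mulmxBr dD (ad_derivation d) !brDl !brDr !brNl !brNr.
  by rewrite opprD addrACA.
have trE y : \tr (ad y *m E) = 0.
  by rewrite DE mulmxBr raddfB /= -Hd killingC subrr.
apply/eqP; rewrite -subr_eq0 -DE; apply/eqP/row_matrixP=> i; rewrite row0 rowE.
apply: killing_nondegenerate => b; set a := delta_mx _ _.
have adE' : ad (a *m E) = ad a *m E - E *m ad a.
  by apply/row_matrixP=> k; rewrite !rowE mulmxBr !mulmxA !adE dE addrK.
rewrite -(trE (br a b)) ad_br /killing adE' !mulmxBl !raddfB /= -!mulmxA; congr (_ - _).
  by rewrite [RHS]mxtrace_mulC -mulmxA.
by rewrite [LHS]mxtrace_mulC -mulmxA.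
Qed.

End LieAlgebra.

(** * Jordan decomposition and generic elements *)

Section CommutingPairs.
Variables (F : closedFieldType) (n : nat).
Implicit Types (A B : 'M[F]_n.+1) (v : 'rV[F]_n.+1).

Lemma gen_null_addC A B v j k : A *m B = B *m A ->
  v *m A ^+ j = 0 -> v *m B ^+ k = 0 -> v *m (A + B) ^+ (j + k) = 0.
Proof.
move=> AB; move Em: (j + k)%N => m.
elim: m j k v Em => [|m IH] [|j] [|k] // v.
- by move=> _; rewrite expr0 mulmx1 => ->; rewrite !mul0mx.
- by move=> _ _; rewrite expr0 mulmx1 => ->; rewrite mul0mx.
rewrite addSn => -[Em] vA vB; rewrite exprS -mulmxE mulmxA mulmxDr mulmxDl.
have cX (C D : 'M[F]_n.+1) i : C *m D = D *m C -> C *m D ^+ i = D ^+ i *m C.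
  by move=> cCD; have := @commrX _ C D i; rewrite /GRing.comm -!mulmxE; apply.
have -> : v *m A *m (A + B) ^+ m = 0.
  apply: (IH j k.+1) => //; first by rewrite -mulmxA mulmxE -exprS.
  by rewrite -mulmxA cX // mulmxA vB mul0mx.
have -> : v *m B *m (A + B) ^+ m = 0.
  apply: (IH j.+1 k); first by rewrite addSn -addnS.
    by rewrite -mulmxA cX // mulmxA vA mul0mx.
  by rewrite -mulmxA mulmxE -exprS.
by rewrite addr0.
Qed.

Lemma gen_eigen_uniq A v a b j k :
  v *m (A - a%:M) ^+ j = 0 -> v *m (A - b%:M) ^+ k = 0 -> v != 0 -> a = b.
Proof.
have [p Hp] := spectral_poly A (fun x => (x == a)%:R).
move=> /Hp; rewrite eqxx scale1r => E /Hp; rewrite E => Ev v0.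
by apply/eqP; apply: contraR v0 => /negPf ab; rewrite Ev [b == a]eq_sym ab scale0r.
Qed.

Lemma avoid_seq (s : seq F) : exists t, t \notin s.
Proof.
have [t] : exists t, ~~ root (\prod_(z <- s) ('X - z%:P)) t.
  by apply/closed_nonrootP; rewrite monic_neq0 // monic_prod_XsubC.
by rewrite root_prod_XsubC; exists t.
Qed.

(** On a joint generalised eigenvector with eigenvalues [la] and [mu], the combination has
    eigenvalue [la + t * mu]. Outside the finitely many ratios [- la / mu] this vanishes only when
    both eigenvalues do. *)
Lemma gen_null_pair A B : A *m B = B *m A -> exists t, forall v,
  v *m (A + t *: B) ^+ n.+1 = 0 -> v *m A ^+ n.+1 = 0 /\ v *m B ^+ n.+1 = 0.
Proof.
move=> AB.
have [rA DA] := closed_field_poly_normal (char_poly A).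
have [rB DB] := closed_field_poly_normal (char_poly B).
have rootsP (C : 'M[F]_n.+1) rs la : char_poly C = lead_coef (char_poly C) *: \prod_(z <- rs) ('X - z%:P) ->
    root (char_poly C) la -> la \in rs.
  by rewrite (monicP (char_poly_monic C)) scale1r => ->; rewrite root_prod_XsubC.
have [t] := avoid_seq (0 :: [seq - la / mu | la <- rA, mu <- rB]).
rewrite inE negb_or => /andP[t0 tn]; exists t => v Hv; set M := A + t *: B in Hv.
have cX (C D : 'M[F]_n.+1) p : C *m D = D *m C -> C *m horner_mx D p = horner_mx D p *m C.
  by move=> cCD; exact: (comm_mx_horner p cCD).
have cpow (C D : 'M[F]_n.+1) i : C *m D = D *m C -> C *m D ^+ i = D ^+ i *m C.
  by move=> cCD; have := @commrX _ C D i; rewrite /GRing.comm -!mulmxE; apply.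
have AM : A *m M = M *m A by rewrite mulmxDr mulmxDl -scalemxAr -scalemxAl AB.
have BM : B *m M = M *m B by rewrite mulmxDr mulmxDl -scalemxAr -scalemxAl AB.
have comp (C D : 'M[F]_n.+1) (u : 'rV[F]_n.+1) p : C *m D = D *m C -> u *m D = 0 ->
    u *m horner_mx C p *m D = 0.
  by move=> cCD uD; rewrite -mulmxA -cX ?mulmxA ?uD ?mul0mx.
apply: (@gen_eigen_ind _ _ A v (fun u => u *m A ^+ n.+1 = 0 /\ u *m B ^+ n.+1 = 0)).
  by move=> u w [u1 u2] [w1 w2]; rewrite !mulmxDl u1 u2 w1 w2 addr0.
move=> p la k; have := comp A _ v p (cpow A M n.+1 AM) Hv.
move: (v *m _) => {Hv}u Hv uA.
apply: (@gen_eigen_ind _ _ B u (fun u => u *m A ^+ n.+1 = 0 /\ u *m B ^+ n.+1 = 0)).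
  by move=> u' w [u1 u2] [w1 w2]; rewrite !mulmxDl u1 u2 w1 w2 addr0.
have BA : B *m (A - la%:M) = (A - la%:M) *m B.
  by rewrite mulmxBr mulmxBl AB mul_mx_scalar mul_scalar_mx.
move=> q mu j; have := comp B _ u q (cpow _ _ _ BM) Hv; have := comp B _ u q (cpow _ _ _ BA) uA.
move: (u *m _) => {uA Hv}w wA wM wB.
have [->|w0] := eqVneq w 0; first by rewrite !mul0mx.
have tB : w *m (t *: (B - mu%:M)) ^+ j = 0 by rewrite exprZn -scalemxAr wB scaler0.
have := gen_null_addC _ wA tB.
have -> : A - la%:M + t *: (B - mu%:M) = M - (la + t * mu)%:M.
  by rewrite scalerBr scale_scalar_mx raddfD opprD addrACA.
have cC : (A - la%:M) *m (t *: (B - mu%:M)) = t *: (B - mu%:M) *m (A - la%:M).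
  rewrite -scalemxAr -scalemxAl; move: (A - la%:M) BA => L BL.
  by rewrite mulmxBr mulmxBl BL mul_mx_scalar mul_scalar_mx.
move=> /(_ cC) wLM; have wM' : w *m (M - 0%:M) ^+ n.+1 = 0 by rewrite raddf0 subr0.
have /esym E := gen_eigen_uniq wM' wLM w0.
have raA : root (char_poly A) la by apply: contraNT w0 => /gen_eigen_nonroot/(_ wA)->.
have rbB : root (char_poly B) mu by apply: contraNT w0 => /gen_eigen_nonroot/(_ wB)->.
have mu0 : mu = 0.
  apply/eqP/negPn/negP => mu0; case/negP: tn; apply/allpairsP; exists (la, mu).
  rewrite (rootsP _ _ _ DA raA) (rootsP _ _ _ DB rbB); split=> //=.
  by move/eqP: E; rewrite addrC addr_eq0 => /eqP <-; rewrite mulfK.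
have la0 : la = 0 by move: E; rewrite mu0 mulr0 addr0.
move: (gen_eigen_bound wA) (gen_eigen_bound wB).
by rewrite la0 mu0 raddf0 !subr0.
Qed.

End CommutingPairs.

(** * Jordan parts as elements of a semisimple Lie algebra *)

Section JordanElements.
Variables (F : closedFieldType) (n : nat).
Local Notation V := 'rV[F]_n.+1.
Variable br : V -> V -> V.
Hypothesis Lbr : lie_algebra br.
Local Notation ad := (ad br).
Local Notation killing := (killing br).
Implicit Types (x y z : V).

Lemma ad_commute x y : br x y = 0 -> ad x *m ad y = ad y *m ad x.
Proof.
by move=> xy; apply/eqP; rewrite eq_sym -subr_eq0 -(ad_br Lbr) xy (ad0 Lbr).
Qed.

Lemma semisimple_eltD x y : br x y = 0 -> semisimple_elt br x -> semisimple_elt br y ->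
  semisimple_elt br (x + y).
Proof.
move=> xy sx sy; rewrite /semisimple_elt (adD Lbr) -[ad y]scale1r.
by apply: diagonalizable_mxD_comm => //; apply: ad_commute.
Qed.

(** The rows of [C] are added one at a time with coefficients from [gen_null_pair]; sums and
    multiples then reach all of [C], whose elements have commuting adjoints. *)
Lemma generic_element (C : 'M[F]_n.+1) :
    (forall x y, (x <= C)%MS -> (y <= C)%MS -> br x y = 0) ->
  exists x, (x <= C)%MS /\ forall v : V, v *m ad x ^+ n.+1 = 0 ->
    forall y, (y <= C)%MS -> v *m ad y ^+ n.+1 = 0.
Proof.
move=> aC.
have [x [xC Hx]] : exists x, (x <= C)%MS /\ forall v : V, v *m ad x ^+ n.+1 = 0 ->
    forall j, v *m ad (row j C) ^+ n.+1 = 0.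
  suff H i : exists x, (x <= C)%MS /\ forall v : V, v *m ad x ^+ n.+1 = 0 ->
      forall j : 'I_n.+1, (j < i)%N -> v *m ad (row j C) ^+ n.+1 = 0.
    by have [x [xC Hx]] := H n.+1; exists x; split=> // v /Hx Hv j; apply: Hv.
  elim: i => [|i [x [xC Hx]]]; first by exists 0; rewrite sub0mx.
  have [ni|ni] := leqP n.+1 i.
    by exists x; split=> // v /Hx Hv j _; apply: Hv; apply: leq_trans ni.
  pose y := row (Ordinal ni) C; have yC : (y <= C)%MS by apply: row_sub.
  have [t Ht] := gen_null_pair (ad_commute (aC _ _ xC yC)).
  exists (x + t *: y); split; first by rewrite addmx_sub // scalemx_sub.
  move=> v; rewrite (adD Lbr) (adZ Lbr) => /Ht[vx vy] j; rewrite ltnS leq_eqVlt.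
  by case/predU1P=> [ji|]; [rewrite (_ : j = Ordinal ni) //; apply: val_inj | apply: Hx].
exists x; split=> // v /Hx Hv y /submxP[a ->]; rewrite [a *m C]mulmx_sum_row.
suff [] : ((\sum_i a 0 i *: row i C)%R <= C)%MS /\ v *m ad (\sum_i a 0 i *: row i C) ^+ n.+1 = 0 by [].
elim/big_ind: _ => [|u w [uC Hu] [wC Hw]|i _].
- by rewrite sub0mx (ad0 Lbr) expr0n mulmx0.
- split; first exact: addmx_sub.
  have := gen_null_addC (ad_commute (aC _ _ uC wC)) Hu Hw; rewrite -(adD Lbr) => H.
  by have := @gen_eigen_bound _ _ (ad (u + w)) v 0 _; rewrite raddf0 subr0; apply; exact: H.
- by rewrite scalemx_sub ?row_sub // (adZ Lbr) exprZn -scalemxAr Hv scaler0.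
Qed.

Hypotheses (charF : [pchar F] =i pred0) (ss : semisimple_lie br).

Lemma ad_inj x y : ad x = ad y -> x = y.
Proof.
move=> E; apply/eqP; rewrite -subr_eq0; apply/eqP; apply: (killing_nondegenerate Lbr charF ss) => z.
by rewrite /killing (adD Lbr) (adN Lbr) E subrr mul0mx mxtrace0.
Qed.

(** The identity function is additive, so the semisimple part of [ad x] is a derivation, hence
    inner. Its action on generalised eigenspaces is kept in the statement because it determines
    [s]. *)
Lemma jordan_element x : exists s, semisimple_elt br s /\
  forall (v : V) la k, v *m (ad x - la%:M) ^+ k = 0 -> br s v = la *: v.
Proof.
have [p Hp] := spectral_poly (ad x) id.
have [s Ds] := derivation_inner Lbr charF ss
  (spectral_derivation Lbr (ad_derivation Lbr x) (fun a b _ _ _ => erefl (a + b)) Hp).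
have Hs (v : V) la k : v *m (ad x - la%:M) ^+ k = 0 -> br s v = la *: v.
  by move=> /Hp; rewrite Ds (adE Lbr).
exists s; split=> //; apply: (@diagonalizable_of_gen_eigen _ _ (ad x) _ id) => v la k.
by rewrite (adE Lbr); apply: Hs.
Qed.

Lemma jordan_nilpotent x s :
    (forall (v : V) la k, v *m (ad x - la%:M) ^+ k = 0 -> br s v = la *: v) ->
  ad (x - s) ^+ n.+1 = 0.
Proof.
move=> Hs; apply: (@gen_eigen_mx _ _ (ad x)) => v la k /gen_eigen_bound; rewrite mulmx0.
suff H m : forall v : V, v *m (ad x - la%:M) ^+ m = 0 -> v *m ad (x - s) ^+ m = 0 by exact: H.
elim: m => [|m IH] {}v; first by rewrite !expr0.
rewrite ![_ ^+ m.+1]exprS -!mulmxE !mulmxA => Hv.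
have -> : v *m ad (x - s) = v *m (ad x - la%:M).
  rewrite !(adE Lbr) (brDl Lbr) (brNl Lbr) mulmxBr (adE Lbr) mul_mx_scalar (Hs v la m.+1) //.
  by rewrite exprS -mulmxE mulmxA.
exact: IH.
Qed.

(** [tau] carries the generalised [la]-eigenspace of [ad x] to the one for [e * la], so both sides
    act by the same scalars, and [ad] is injective. *)
Lemma jordan_equivariant (tau : 'M[F]_n.+1) e x s :
    lie_aut br tau -> tau *m tau = 1%:M -> e * e = 1 -> x *m tau = e *: x ->
    (forall (v : V) la k, v *m (ad x - la%:M) ^+ k = 0 -> br s v = la *: v) ->
  s *m tau = e *: s.
Proof.
move=> [_ at_] t2 e2 xt Hs; apply: ad_inj; rewrite (adZ Lbr).
have tK (v : V) : v *m tau *m tau = v by rewrite -mulmxA t2 mulmx1.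
apply: (@gen_eigen_mx _ _ (ad x)) => v la k Hv.
have Hw : v *m tau *m (ad x - (e * la)%:M) ^+ k = 0.
  have -> : v *m tau *m (ad x - (e * la)%:M) ^+ k = e ^+ k *: (v *m (ad x - la%:M) ^+ k *m tau).
    elim: k v {Hv} => [|k IH] v; first by rewrite !expr0 !mulmx1 scale1r.
    rewrite !exprS -!mulmxE !mulmxA.
    have -> : v *m tau *m (ad x - (e * la)%:M) = e *: (v *m (ad x - la%:M)) *m tau.
      rewrite !mulmxBr !(adE Lbr) !mul_mx_scalar -scalemxAl mulmxBl -at_ xt (brZl Lbr).
      by rewrite scalerBr !scalerA e2 scale1r -scalemxAl scalerA.
    by rewrite -scalemxAl -scalemxAl IH scalerA.
  by rewrite Hv mul0mx scaler0.
rewrite -scalemxAr !(adE Lbr) (Hs _ _ _ Hv) -[v in LHS]tK at_ (Hs _ _ _ Hw).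
by rewrite -scalemxAl tK scalerA.
Qed.

Lemma killing_nilpotent x y k : br x y = 0 -> ad x ^+ k = 0 -> killing x y = 0.
Proof.
move=> /ad_commute xy xk; apply: (@mxtrace_nilpotent _ _ _ k).
by rewrite mulmxE exprMn_comm ?xk ?mul0r.
Qed.

Lemma ad_aut (tau : 'M[F]_n.+1) x : lie_aut br tau -> tau *m tau = 1%:M ->
  ad (x *m tau) = tau *m ad x *m tau.
Proof.
move=> [_ at_] t2; apply/row_matrixP=> i; rewrite !rowE !mulmxA !(adE Lbr) -at_.
by rewrite -[_ *m tau *m tau]mulmxA t2 mulmx1.
Qed.

Lemma killing_aut (tau : 'M[F]_n.+1) x y : lie_aut br tau -> tau *m tau = 1%:M ->
  killing (x *m tau) (y *m tau) = killing x y.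
Proof.
move=> a t2; rewrite /killing !ad_aut // !mulmxA -(mulmxA _ tau tau) t2 mulmx1.
by rewrite mxtrace_mulC !mulmxA t2 mul1mx.
Qed.

End JordanElements.

(** * Symmetric pairs *)

Section SymmetricPairs.
Variables (F : closedFieldType) (n : nat).
Local Notation V := 'rV[F]_n.+1.
Variable br : V -> V -> V.
Hypothesis Lbr : lie_algebra br.
Local Notation ad := (ad br).
Local Notation killing := (killing br).
Implicit Types (x y z u v w : V).
Hypotheses (charF : [pchar F] =i pred0) (ss : semisimple_lie br).

Lemma eigspP (s : 'M[F]_n.+1) a v : reflect (v *m s = a *: v) (v <= eigsp s a)%MS.
Proof.
apply: (iffP sub_kermxP); rewrite mulmxBr mul_mx_scalar; first by move/eqP; rewrite subr_eq0 => /eqP.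
by move->; rewrite subrr.
Qed.

Lemma natr_neq0_pchar0 k : (k.+1)%:R != 0 :> F.
Proof. by rewrite (proj1 (pcharf0P F) charF). Qed.

Lemma double_eq0 (x : F) : x + x = 0 -> x = 0.
Proof.
move=> H; apply/eqP; have := mulf_eq0 x 2%:R; rewrite mulr_natr mulr2n H eqxx.
by rewrite (negPf (natr_neq0_pchar0 1)) orbF => <-.
Qed.

Lemma double_mx_eq0 m p (A : 'M[F]_(m, p)) : A + A = 0 -> A = 0.
Proof.
by move/matrixP=> H; apply/matrixP=> i j; have := H i j; rewrite !mxE => /double_eq0.
Qed.

Lemma killing_matrix : exists K : 'M[F]_n.+1, K^T = K /\ forall x y, x *m K *m y^T = (killing x y)%:M.
Proof.
exists (\matrix_(i, j) killing (delta_mx 0 i) (delta_mx 0 j)); split.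
  by apply/matrixP=> i j; rewrite !mxE killingC.
set K := \matrix_(i, j) _ => x y.
suff E : (x *m K *m y^T) 0 0 = killing x y by rewrite [LHS]mx11_scalar E.
apply: (@linear_form_ext _ _ (fun x => (x *m K *m y^T) 0 0) (killing^~ y)) x => [a u w|a u w|i].
- by rewrite !mulmxDl -!scalemxAl !mxE.
- exact: killing_linl.
apply: (@linear_form_ext _ _ (fun y => (_ *m K *m y^T) 0 0) (killing _)) y => [a u w|a u w|j].
- by rewrite linearP mulmxDr -scalemxAr !mxE.
- exact: killing_linr.
by rewrite -rowE trmx_delta -colE !mxE.
Qed.

Lemma rV_pairing_ext (M N : 'M[F]_n.+1) :
  (forall a b : V, a *m M *m b^T = a *m N *m b^T) -> M = N.
Proof.
move=> H; apply/matrixP=> i j; have /matrixP/(_ 0 0) := H (delta_mx 0 i) (delta_mx 0 j).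
by rewrite -!rowE trmx_delta -!colE !mxE.
Qed.

Section OneInvolution.
Variable s : 'M[F]_n.+1.
Hypothesis inv_s : involution br s.

Let aut_s : lie_aut br s. Proof. by case: inv_s. Qed.
Let s2 : s *m s = 1%:M. Proof. by case: inv_s. Qed.

Lemma br_inv x y : br x y *m s = br (x *m s) (y *m s).
Proof. by case: aut_s => _ ->. Qed.

Lemma invK v : v *m s *m s = v.
Proof. by rewrite -mulmxA s2 mulmx1. Qed.

Lemma killing_eig e u v : e * e = 1 -> (u <= eigsp s e)%MS -> killing u (v *m s) = e * killing u v.
Proof.
move=> e2 /eigspP us; rewrite -(killing_aut Lbr u (v *m s) aut_s s2) invK us.
by rewrite -[e *: u]addr0 killing_linl // /killing (ad0 Lbr) mul0mx mxtrace0 addr0.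
Qed.

Lemma killing_eig_nondegenerate e u : e * e = 1 -> (u <= eigsp s e)%MS ->
  (forall w, (w <= eigsp s e)%MS -> killing u w = 0) -> u = 0.
Proof.
move=> e2 us H; apply: (killing_nondegenerate Lbr charF ss) => v; apply: double_eq0.
have : killing u (e *: (v *m s) + v) = 0.
  by apply/H/eigspP; rewrite mulmxDl -scalemxAl invK scalerDr scalerA e2 scale1r addrC.
by rewrite killing_linr // (killing_eig v e2 us) mulrA e2 mul1r.
Qed.

(* The two off-diagonal blocks of [ad y] are adjoint up to sign for the Killing form, hence of the same rank. *)
Lemma kostant_rallis y : (y <= eigsp s (-1))%MS ->
  (\rank (eigsp s (-1)%R :&: kermx (ad y))%MS + \rank (eigsp s 1) =
   \rank (eigsp s 1%R :&: kermx (ad y))%MS + \rank (eigsp s (-1)))%N.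
Proof.
move=> /eigspP ys; have [K [KT HK]] := killing_matrix.
(* The Killing form is nondegenerate on each eigenspace, so pairing with the eigenspace preserves
   rank and the rank of a block can be read off its Gram matrix. *)
have rk e (X : 'M[F]_n.+1) : e * e = 1 -> (X <= eigsp s e)%MS ->
    \rank (X *m (K *m (eigsp s e)^T)) = \rank X.
  move=> e2 Xe; rewrite -(mxrank_mul_ker X (K *m (eigsp s e)^T)).
  suff -> : (X :&: kermx (K *m (eigsp s e)^T))%MS = 0 by rewrite mxrank0 addn0.
  apply/eqP/rowV0P => u; rewrite sub_capmx => /andP[uX /sub_kermxP uK].
  apply: (killing_eig_nondegenerate e2 (submx_trans uX Xe)) => w /submxP[a Dw].
  have := HK u w; rewrite Dw trmx_mul mulmxA -(mulmxA u) uK mul0mx.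
  by move/matrixP/(_ 0 0); rewrite !mxE.
have inv : ad y *m K = - (K *m (ad y)^T).
  apply: rV_pairing_ext => a b; rewrite mulmxN mulNmx !mulmxA (adE Lbr) HK.
  rewrite -(mulmxA _ (ad y)^T) -trmx_mul (adE Lbr) HK (brC Lbr) -raddfN /=.
  rewrite -(killing_br Lbr) -mulN1r -[- br a y]addr0 -scaleN1r killing_linl //.
  by rewrite /killing (ad0 Lbr) mul0mx mxtrace0 addr0.
have sub e : (eigsp s e *m ad y <= eigsp s (- e))%MS.
  apply/rV_subP=> v /submxP[a ->]; rewrite mulmxA; have := submxMl a (eigsp s e).
  move: (a *m _) => w /eigspP ws; apply/eigspP.
  by rewrite (adE Lbr) br_inv ys ws (brZr Lbr) scaleN1r (brNl Lbr) scalerN scaleNr.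
have swap (P Q : 'M[F]_n.+1) : \rank (P *m ad y *m (K *m Q^T)) = \rank (Q *m ad y *m (K *m P^T)).
  rewrite -mxrank_tr !trmx_mul trmxK KT -!mulmxA.
  have -> : K *m ((ad y)^T *m P^T) = - (ad y *m (K *m P^T)).
    by rewrite !mulmxA inv mulNmx opprK.
  by rewrite mulmxN mxrank_opp.
have r1 : \rank (eigsp s 1 *m ad y) = \rank (eigsp s (-1) *m ad y).
  rewrite -(rk (-1)) ?mulrNN ?mulr1 ?sub // -[RHS](rk 1) ?mulr1 //; last first.
    by have := sub (-1); rewrite opprK.
have := mxrank_mul_ker (eigsp s (-1)) (ad y); have := mxrank_mul_ker (eigsp s 1) (ad y); rewrite r1; lia.
Qed.

(* As [h] lies in the (-1)-eigenspace it is abelian, so its generic element has [h] as generalised null space. *)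
Lemma cartan_subalgebra_generic h : cartan_subalgebra br h -> (h <= eigsp s (-1))%MS ->
  (forall x y, (x <= h)%MS -> (y <= h)%MS -> br x y = 0) /\
  exists y, (y <= h)%MS /\ forall v, v *m ad y ^+ n.+1 = 0 -> (v <= h)%MS.
Proof.
move=> [sh _ Nh] hs.
have ah x y : (x <= h)%MS -> (y <= h)%MS -> br x y = 0.
  move=> xh yh; have /eigspP xs := submx_trans xh hs; have /eigspP ys := submx_trans yh hs.
  have /eigspP := submx_trans (sh x y xh yh) hs; rewrite br_inv xs ys !scaleN1r (brNl Lbr) (brNr Lbr) opprK.
  by move=> E; apply: double_mx_eq0; rewrite {1}E addNr.
split=> //; have [y [yh Hy]] := generic_element Lbr ah; exists y; split=> // v Hv.
have hv := Hy v Hv; apply/negPn/negP => vh.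
(* An Engel argument for commuting operators: from a generalised null vector outside [h], produce
   one that all of [h] sends into [h]. It normalises [h], against self-normalisation. Row [i] is
   treated by taking the last iterate outside [h]. *)
suff H i : exists u, [/\ forall x, (x <= h)%MS -> u *m ad x ^+ n.+1 = 0, ~~ (u <= h)%MS &
    forall j : 'I_n.+1, (j < i)%N -> (br (row j h) u <= h)%MS].
  have [u [_ /negP uh ju]] := H n.+1; apply: uh; apply: Nh => x /submxP[a ->].
  rewrite (brC Lbr) mulmx_sum_row -scaleN1r scalemx_sub //.
  elim/big_ind: _ => [|z w Hz Hw|j _]; first by rewrite (br0l Lbr) sub0mx.
    by rewrite (brDl Lbr) addmx_sub.
  by rewrite (brZl Lbr) scalemx_sub // ju.
elim: i => [|i [u [uN uh ju]]]; first by exists v.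
have [ni|ni] := leqP n.+1 i.
  by exists u; split=> // j _; apply: ju; apply: leq_trans ni.
pose x := row (Ordinal ni) h; have xh : (x <= h)%MS by apply: row_sub.
pose w k := u *m ad x ^+ k.
have wS k : w k.+1 = br x (w k) by rewrite /w exprSr -mulmxE mulmxA (adE Lbr).
have ex : exists k, (w k <= h)%MS by exists n.+1; rewrite /w uN // sub0mx.
case: (ex_minnP ex) => -[|k] wk mk; first by move: wk; rewrite /w expr0 mulmx1 (negPf uh).
exists (w k); split; last first.
- move=> j; rewrite ltnS leq_eqVlt => /predU1P[ji|ji].
    by rewrite (_ : row j h = x) -?wS //; congr row; apply: val_inj.
  elim: k {wk mk} => [|k IH]; first by rewrite /w expr0 mulmx1 ju.
  by rewrite wS (jacobi Lbr) addmx_sub // ?(ah (row j h) x) ?row_sub // ?(br0l Lbr) ?sub0mx // ah ?sub0mx.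
- by apply/negP=> /mk; rewrite ltnn.
move=> z zh; rewrite /w -mulmxA.
have cX : GRing.comm (ad z ^+ n.+1) (ad x ^+ k).
  by apply: commrX; apply: commr_sym; apply: commrX; exact: (ad_commute Lbr (ah _ _ xh zh)).
by rewrite mulmxE -cX -mulmxE mulmxA uN // mul0mx.
Qed.

End OneInvolution.

(** * Commuting involutions and the centralizer of a Cartan subspace *)

Section TwoInvolutions.
Variables s1 s2 : 'M[F]_n.+1.
Hypotheses (inv1 : involution br s1) (inv2 : involution br s2) (s12 : s1 *m s2 = s2 *m s1).

Lemma gijP i j v : reflect (v *m s1 = (-1) ^+ i *: v /\ v *m s2 = (-1) ^+ j *: v)
  (v <= gij s1 s2 i j)%MS.
Proof.
rewrite sub_capmx; apply: (iffP andP) => -[].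
  by move=> /eigspP -> /eigspP ->.
by move=> H1 H2; split; apply/eigspP.
Qed.

Lemma semisimple_ker_im x v : semisimple_elt br x -> exists a w, v = a + br x w /\ br x a = 0.
Proof.
move=> sx; have D0 : (kermx (ad x) :&: ad x)%MS = 0.
  apply/eqP/rowV0P => u; rewrite sub_capmx => /andP[/sub_kermxP ux /submxP[w Dw]].
  by rewrite Dw; apply: (diagonalizable_mx_gen_ker (k := 2) sx); rewrite expr2 -mulmxE mulmxA -Dw.
have full : row_full (kermx (ad x) + ad x)%MS.
  by rewrite /row_full mxrank_disjoint_sum // mxrank_ker subnK // rank_leq_row.
have /sub_addsmxP[[a w] /= ->] : (v <= kermx (ad x) + ad x)%MS by apply: submx_full.
exists (a *m kermx (ad x)), w; rewrite !(adE Lbr); split=> //.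
by rewrite -(adE Lbr) -mulmxA mulmx_ker mulmx0.
Qed.

Lemma semisimple_centralizer C x : comm_ss_subspace br C ->
    (forall v : V, v *m ad x ^+ n.+1 = 0 -> forall y, (y <= C)%MS -> v *m ad y ^+ n.+1 = 0) ->
  forall v, br x v = 0 -> forall c, (c <= C)%MS -> br c v = 0.
Proof.
move=> [_ sC] Hx v xv c cC; rewrite -(adE Lbr); apply: (diagonalizable_mx_gen_ker (k := n.+1)); first exact: sC.
by apply: Hx => //; rewrite exprS -mulmxE mulmxA (adE Lbr) xv mul0mx.
Qed.

Variable C : 'M[F]_n.+1.
Hypothesis cC : cartan_subspace br (gij s1 s2 1 1) C.

(** The semisimple part [t] of [u] kills whatever [ad u] kills, so it commutes with [C], and
    equivariance places it in [gij 1 1]. Hence [C + t] is again commuting and semisimple, and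
    maximality gives [t] in [C]. *)
Lemma cartan_centralizer_jordan u : (u <= gij s1 s2 1 1)%MS ->
    (forall c, (c <= C)%MS -> br c u = 0) ->
  exists2 t, (t <= C)%MS & ad (u - t) ^+ n.+1 = 0.
Proof.
case: cC => Cg [aC sC] maxC; rewrite -/1%N => /gijP[]; rewrite !expr1 => u1 u2 Hu.
have [t [st Ht]] := jordan_element Lbr charF ss u; exists t; last exact: (jordan_nilpotent Lbr) Ht.
have tc c : (c <= C)%MS -> br t c = 0.
  move=> cC'; rewrite (Ht c 0 1%N) ?scale0r // raddf0 subr0 expr1 (adE Lbr) (brC Lbr).
  by rewrite Hu ?oppr0.
have nn : -1 * -1 = 1 :> F by rewrite mulrNN mulr1.
have [a1 i1 _] := inv1; have [a2 i2 _] := inv2.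
apply: submx_trans (addsmxSr C t) _; apply: maxC; first exact: addsmxSl.
  rewrite addsmx_sub Cg; apply/gijP; rewrite !expr1; split.
    exact: (jordan_equivariant Lbr charF ss a1 i1 nn u1 Ht).
  exact: (jordan_equivariant Lbr charF ss a2 i2 nn u2 Ht).
split=> [x y|x].
  move=> /sub_adds_rVP[k [a [kC ->]]] /sub_adds_rVP[l [b [lC ->]]].
  rewrite (brDl Lbr) !(brDr Lbr) !(brZl Lbr) !(brZr Lbr) (brxx Lbr) aC // (brC Lbr k) !tc //.
  by rewrite oppr0 !scaler0 !addr0.
move=> /sub_adds_rVP[k [a [kC ->]]]; apply: (semisimple_eltD Lbr); last first.
- rewrite /semisimple_elt (adZ Lbr) -[_ *: _]add0r.
  apply: diagonalizable_mxD_comm; rewrite ?mul0mx ?mulmx0 //.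
  exists 1%:M; rewrite ?unitmx1 // mul1mx mul0mx.
  by apply/is_diag_mxP => i j _; rewrite mxE.
- exact: sC.
by rewrite (brZr Lbr) (brC Lbr) tc // oppr0 scaler0.
Qed.

(* Semisimple parts stay in [C] by maximality, so the centralizer of [C] in [gij 1 1] is [C] plus nilpotent
   elements; these form an isotropic subspace orthogonal to everything, hence zero. *)
Lemma cartan_centralizer u : (u <= gij s1 s2 1 1)%MS ->
  (forall c, (c <= C)%MS -> br c u = 0) -> (u <= C)%MS.
Proof.
pose L u := (u <= gij s1 s2 1 1)%MS /\ forall c, (c <= C)%MS -> br c u = 0.
case: (cC) => Cg cssC maxC; have [aC sC] := cssC.
have LD a v w : L v -> L w -> L (a *: v + w).
  move=> [v1 v2] [w1 w2]; split=> [|c cC']; first by rewrite addmx_sub ?scalemx_sub.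
  by rewrite (br_linr Lbr) v2 // w2 // scaler0 addr0.
have LC v : (v <= C)%MS -> L v.
  by move=> vC; split=> [|c cC']; [apply: submx_trans Cg | apply: aC].
have kZ x : killing x 0 = 0 by rewrite /killing (ad0 Lbr) mulmx0 mxtrace0.
(* The form stays nondegenerate on [L]: in [w = a + br x z] the second term is orthogonal to [v] by
   invariance, and the centralizing term [a] is moved into [L] by [p] and [q], each of which doubles
   its pairing with [v]. *)
have nondeg v : L v -> (forall w, L w -> killing v w = 0) -> v = 0.
  move=> [/gijP[]]; rewrite !expr1 => v1 v2 vC Hv.
  apply: (killing_nondegenerate Lbr charF ss) => w.
  have [x [xC Hx]] := generic_element Lbr aC.
  have [a [z [-> xa]]] := semisimple_ker_im w (sC x xC).
  rewrite -[a]scale1r killing_linr // mul1r -(killing_br Lbr) (brC Lbr) vC // oppr0 [killing 0 _]killingC kZ addr0.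
  have ca := semisimple_centralizer cssC Hx xa.
  have [[_ at1] i1 _] := inv1; have [[_ at2] i2 _] := inv2.
  have k1 b : killing v (b *m s1) = - killing v b.
    by rewrite (killing_eig inv1 (e := -1)) ?mulrNN ?mulr1 ?mulN1r //; apply/eigspP.
  have k2 b : killing v (b *m s2) = - killing v b.
    by rewrite (killing_eig inv2 (e := -1)) ?mulrNN ?mulr1 ?mulN1r //; apply/eigspP.
  pose p (b : V) : V := b - b *m s1; pose q (b : V) : V := b - b *m s2.
  have kp b : killing v (p b) = killing v b + killing v b.
    by rewrite /p -scaleN1r addrC killing_linr // k1 mulN1r opprK.
  have kq b : killing v (q b) = killing v b + killing v b.
    by rewrite /q -scaleN1r addrC killing_linr // k2 mulN1r opprK.
  apply/double_eq0; rewrite -kp; apply/double_eq0; rewrite -kq; apply: Hv; split.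
    have ps b : p b *m s1 = - p b by rewrite /p mulmxBl (invK inv1) opprB.
    have qs b : q b *m s2 = - q b by rewrite /q mulmxBl (invK inv2) opprB.
    apply/gijP; rewrite !expr1 !scaleN1r qs; split=> //.
    by rewrite {1}/q mulmxBl -mulmxA -s12 mulmxA ps mulNmx -opprD.
  move=> c cC'; have /gijP[] := submx_trans cC' Cg; rewrite !expr1 !scaleN1r => c1 c2.
  have b1 b : br c b = 0 -> br c (b *m s1) = 0.
    by move=> cb; rewrite -[c]opprK -c1 (brNl Lbr) at1 cb mul0mx oppr0.
  have b2 b : br c b = 0 -> br c (b *m s2) = 0.
    by move=> cb; rewrite -[c]opprK -c2 (brNl Lbr) at2 cb mul0mx oppr0.
  have bp b : br c b = 0 -> br c (p b) = 0.
    by move=> cb; rewrite /p (brDr Lbr) (brNr Lbr) cb b1 // subr0.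
  have bq b : br c b = 0 -> br c (q b) = 0.
    by move=> cb; rewrite /q (brDr Lbr) (brNr Lbr) cb b2 // subr0.
  by apply/bq/bp/ca.
have dec v : L v -> exists t m, [/\ v = t + m, (t <= C)%MS, L m & ad m ^+ n.+1 = 0].
  move=> Lv; have [t tC Ht] := cartan_centralizer_jordan Lv.1 Lv.2; exists t, (v - t).
  rewrite addrC subrK; split=> //; rewrite addrC -scaleN1r; apply: LD => //; exact: LC.
have kCN t m : (t <= C)%MS -> L m -> ad m ^+ n.+1 = 0 -> killing t m = 0.
  move=> tC [_ mC] m0; rewrite killingC; apply: (killing_nilpotent Lbr _ m0).
  by rewrite (brC Lbr) mC // oppr0.
have kDr x a b : killing x (a + b) = killing x a + killing x b.
  by rewrite -[a in LHS]scale1r killing_linr // mul1r.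
(* Nilpotency of [v + w] is not evident. Its component [t] in [C] is orthogonal to all of [L], hence
   zero; then [v + w] is nilpotent too, and polarisation finishes. *)
have kNN v w : L v -> L w -> ad v ^+ n.+1 = 0 -> ad w ^+ n.+1 = 0 -> killing v w = 0.
  move=> Lv Lw v0 w0.
  have Lvw : L (v + w) by rewrite -[v]scale1r; apply: LD.
  have [t [m [E tC Lm m0]]] := dec _ Lvw.
  have t0 : t = 0.
    apply: nondeg (LC _ tC) _ => z /dec[t' [m' [-> t'C Lm' m'0]]].
    rewrite kDr (kCN t m') // addr0 killingC.
    have -> : killing t' t = killing t' (t + m) by rewrite kDr (kCN t' m) // addr0.
    by rewrite -E kDr !kCN // addr0.
  have k0 z : ad z ^+ n.+1 = 0 -> killing z z = 0 by apply: killing_nilpotent; rewrite ?(brxx Lbr).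
  move: (k0 m m0); rewrite -[m]add0r -t0 -E !kDr ![killing (v + w) _]killingC !kDr.
  by rewrite !k0 // addr0 add0r [killing w v]killingC => /double_eq0.
move=> ug uC; have [t [m [-> tC Lm m0]]] := dec u (conj ug uC).
suff -> : m = 0 by rewrite addr0.
apply: nondeg => // w /dec[t' [m' [-> t'C Lm' m'0]]].
by rewrite kDr killingC kCN // kNN // addr0.
Qed.

End TwoInvolutions.
End SymmetricPairs.

(** * Deformation along truncated flows *)

(** Arbitrary compressions by [L] and [R] replace submatrices: the condition stays polynomial in [A]
    and behaves well under multiplication of [A] on either side. *)
Lemma rank_le_det (F : fieldType) m k (A : 'M[F]_m) :
  (\rank A <= k)%N <-> forall (L : 'M[F]_(k.+1, m)) (R : 'M[F]_(m, k.+1)), \det (L *m A *m R) = 0.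
Proof.
split=> [rA L R|H].
  apply/eqP; have : ~~ row_free (L *m A *m R).
    rewrite -row_leq_rank -ltnNge ltnS (leq_trans (mxrankM_maxl _ _)) //.
    exact: leq_trans (mxrankM_maxr _ _) rA.
  by rewrite row_free_unit unitmxE unitfE negbK.
rewrite leqNgt; apply/negP => rA.
have [B rB] := row_freeP (row_base_free A); have [C Cc] := row_fullP (col_base_full A).
have E : (pid_mx k.+1 : 'M[F]_(k.+1, \rank A)) *m (C *m A *m B) *m (pid_mx k.+1 : 'M_(\rank A, k.+1)) = 1%:M.
  have -> : C *m A *m B = 1%:M by rewrite -[A in C *m A]mulmx_base mulmxA Cc mul1mx rB.
  by rewrite mulmx1 pid_mx_id // pid_mx_1.
have /eqP := H (pid_mx k.+1 *m C) (B *m pid_mx k.+1).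
by move: E; rewrite -!mulmxA => ->; rewrite det1 oner_eq0.
Qed.

(** * Polynomial matrices modulo powers of the variable *)

Section PolyMatrix.
Variable F : fieldType.
Local Notation P := {poly F}.

Definition coef_mx m p (i : nat) (A : 'M[P]_(m, p)) : 'M[F]_(m, p) := map_mx (fun q : P => q`_i) A.

Lemma coef_mxE m p i (A : 'M[P]_(m, p)) a b : coef_mx i A a b = (A a b)`_i.
Proof. by rewrite mxE. Qed.

Lemma coef_mxD m p i (A B : 'M[P]_(m, p)) : coef_mx i (A + B) = coef_mx i A + coef_mx i B.
Proof. by apply/matrixP=> a b; rewrite !mxE coefD. Qed.

Lemma coef_mxN m p i (A : 'M[P]_(m, p)) : coef_mx i (- A) = - coef_mx i A.
Proof. by apply/matrixP=> a b; rewrite !mxE coefN. Qed.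

Lemma coef_mxM m p r i (A : 'M[P]_(m, p)) (B : 'M[P]_(p, r)) :
  coef_mx i (A *m B) = \sum_(j < i.+1) coef_mx j A *m coef_mx (i - j) B.
Proof.
apply/matrixP=> a b; rewrite !mxE coef_sum summxE.
under eq_bigr do rewrite coefM.
by rewrite exchange_big; apply: eq_bigr => j _; rewrite !mxE; apply: eq_bigr => c _; rewrite !mxE.
Qed.

Lemma coef_mx_const m p i (A : 'M[F]_(m, p)) : coef_mx i (map_mx polyC A) = if i == 0%N then A else 0.
Proof. by apply/matrixP=> a b; rewrite !mxE coefC; case: eqP; rewrite ?mxE. Qed.

Lemma coef_mxXn m p i k (A : 'M[P]_(m, p)) :
  coef_mx i ('X^k *: A) = if (i < k)%N then 0 else coef_mx (i - k) A.
Proof. by apply/matrixP=> a b; rewrite !mxE mulrC coefMXn; case: ltnP; rewrite ?mxE. Qed.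

Lemma mx_split_Xn m p k (A : 'M[P]_(m, p)) : (forall i, (i < k)%N -> coef_mx i A = 0) ->
  exists B, A = 'X^k *: B /\ forall i, coef_mx i B = coef_mx (k + i) A.
Proof.
move=> H; exists (map_mx (drop_poly k) A); split.
  apply/matrixP=> a b; rewrite !mxE -[LHS](poly_take_drop k) (_ : take_poly k _ = 0) ?add0r 1?mulrC //.
  apply/polyP=> i; rewrite coef_take_poly coef0; case: ifP => // /H/matrixP/(_ a b).
  by rewrite !mxE.
by move=> i; apply/matrixP=> a b; rewrite !mxE coef_drop_poly addnC.
Qed.

Definition congr_Xn m p k (A B : 'M[P]_(m, p)) := exists Q, A = B + 'X^k *: Q.

Lemma congr_Xn_coef m p k (A B : 'M[P]_(m, p)) :
  (forall i, (i < k)%N -> coef_mx i A = coef_mx i B) -> congr_Xn k A B.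
Proof.
move=> H; have [i ik|Q [E _]] := @mx_split_Xn m p k (A - B).
  by rewrite coef_mxD coef_mxN H // subrr.
by exists Q; rewrite -E addrC subrK.
Qed.

Lemma congr_Xn_sym m p k (A B : 'M[P]_(m, p)) : congr_Xn k A B -> congr_Xn k B A.
Proof. by case=> Q ->; exists (- Q); rewrite scalerN addrK. Qed.

Lemma congr_Xn_trans m p k (A B C : 'M[P]_(m, p)) : congr_Xn k A B -> congr_Xn k B C -> congr_Xn k A C.
Proof. by case=> Q -> [R ->]; exists (R + Q); rewrite scalerDr addrA. Qed.

Lemma congr_XnMl m p r k (C : 'M[P]_(r, m)) (A B : 'M[P]_(m, p)) :
  congr_Xn k A B -> congr_Xn k (C *m A) (C *m B).
Proof. by case=> Q ->; exists (C *m Q); rewrite mulmxDr scalemxAr. Qed.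

Lemma congr_XnMr m p r k (C : 'M[P]_(p, r)) (A B : 'M[P]_(m, p)) :
  congr_Xn k A B -> congr_Xn k (A *m C) (B *m C).
Proof. by case=> Q ->; exists (Q *m C); rewrite mulmxDl scalemxAl. Qed.

Lemma congr_Xn_det m k (A B : 'M[P]_m) : congr_Xn k A B -> 'X^k %| \det A - \det B.
Proof.
case=> Q ->; rewrite /determinant -sumrB; elim/big_ind: _ => [|p q|s _]; first exact: dvdp0.
  exact: dvdp_add.
rewrite -mulrBr dvdp_mull //.
elim/big_ind2: _ => [|a b c d ab cd|i _]; first by rewrite subrr dvdp0.
  have -> : b * d - a * c = (b - a) * d + a * (d - c) by ring.
  by apply: dvdp_add; [apply: dvdp_mulr | apply: dvdp_mull].
by rewrite !mxE [B _ _ + _]addrC addrK dvdp_mulr.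
Qed.

(** Rank at most [k] modulo ['X^d]. Polynomial [L] and [R] let matrix factors be absorbed. *)
Definition minors_vanish m k d (A : 'M[P]_m) :=
  forall (L : 'M[P]_(k.+1, m)) (R : 'M[P]_(m, k.+1)), 'X^d %| \det (L *m A *m R).

Lemma minors_vanish_congr m k d (A B : 'M[P]_m) :
  congr_Xn d A B -> minors_vanish k d A -> minors_vanish k d B.
Proof.
move=> AB H L R; rewrite -[\det _](subKr (\det (L *m A *m R))).
rewrite dvdp_sub // congr_Xn_det //.
by apply: congr_XnMr; apply: congr_XnMl.
Qed.

(** [E] need not be invertible over polynomials. Its adjugate, absorbed in [R], leaves a power of
    [\det E], which is coprime to ['X] because [E] is invertible at 0. *)
Lemma minors_vanish_conj m k d (A B E : 'M[P]_m) :
    ~~ root (\det E) 0 -> congr_Xn d (E *m B) (A *m E) ->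
  minors_vanish k d B -> minors_vanish k d A.
Proof.
move=> E0 EB H.
have HAE : minors_vanish k d (A *m E).
  by apply: minors_vanish_congr EB _ => L R; rewrite !mulmxA.
move=> L R; have := HAE L (\adj E *m R).
rewrite !mulmxA -(mulmxA _ E) mul_mx_adj mul_mx_scalar -scalemxAl detZ.
rewrite Gauss_dvdpr // coprimep_expr // coprimep_expl //.
by rewrite -[X in coprimep X]subr0 coprimep_sym coprimep_XsubC.
Qed.

End PolyMatrix.

Section DividedPowers.
Variables (F : fieldType) (n : nat).
Hypothesis charF : [pchar F] =i pred0.
Implicit Types (Z : 'M[F]_n.+1).

Definition divpow Z j := (j`!%:R)^-1 *: Z ^+ j.

Lemma divpow0 Z : divpow Z 0 = 1%:M.
Proof. by rewrite /divpow invr1 scale1r. Qed.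

Lemma divpow1 Z : divpow Z 1 = Z.
Proof. by rewrite /divpow invr1 scale1r. Qed.

Lemma divpowSr Z j : divpow Z j *m Z = j.+1%:R *: divpow Z j.+1.
Proof.
have cf i : i.+1%:R != 0 :> F by rewrite (proj1 (pcharf0P F) charF).
rewrite /divpow -scalemxAl scalerA exprSr factS natrM invfM mulrA divff //.
by rewrite mul1r mulmxE.
Qed.

(* With [A_i = A (v Z^i / i!)] this is [exp (t Z) * A (v exp (t Z)) = A v * exp (t Z)], coefficient by coefficient. *)
Lemma divpow_leibniz Z (A : 'rV[F]_n.+1 -> 'M[F]_n.+1) v m :
    (forall a u w, A (a *: u + w) = a *: A u + A w) ->
    (forall u, A u *m Z = Z *m A u + A (u *m Z)) ->
  \sum_(i < m.+1) divpow Z (m - i) *m A (v *m divpow Z i) = A v *m divpow Z m.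
Proof.
move=> lA AZ.
have A0 : A 0 = 0 by have := lA 1 0 0; rewrite scaler0 addr0 scale1r => /eqP; rewrite -subr_eq subrr => /eqP.
have AZl a u : A (a *: u) = a *: A u by rewrite -[a *: u]addr0 lA A0 addr0.
have cf i : i.+1%:R != 0 :> F by rewrite (proj1 (pcharf0P F) charF).
elim: m => [|m IH]; first by rewrite big_ord1 subnn divpow0 mul1mx !mulmx1.
apply: (scalerI (cf m)); rewrite scalemxAr -divpowSr mulmxA -IH mulmx_suml.
pose G i := divpow Z (m.+1 - i) *m A (v *m divpow Z i).
have E (i : 'I_m.+1) : divpow Z (m - i) *m A (v *m divpow Z i) *m Z
    = (m.+1 - i)%:R *: G i + i.+1%:R *: G i.+1.
  have Dv : v *m divpow Z i *m Z = i.+1%:R *: (v *m divpow Z i.+1).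
    by rewrite -mulmxA divpowSr scalemxAr.
  rewrite -mulmxA AZ mulmxDr mulmxA divpowSr Dv (AZl i.+1%:R).
  have im : (i <= m)%N by rewrite -ltnS.
  by rewrite /G subSS subSn // -[_ *m A (v *m divpow Z i) in LHS]scalemxAl -(scalemxAr i.+1%:R).
rewrite (eq_bigr _ (fun i _ => E i)) big_split /=.
have -> : \sum_(i < m.+1) (m.+1 - i)%:R *: G i = \sum_(i < m.+2) (m.+1 - i)%:R *: G i.
  by rewrite [RHS]big_ord_recr /= subnn scale0r addr0.
have -> : \sum_(i < m.+1) i.+1%:R *: G i.+1 = \sum_(i < m.+2) i%:R *: G i.
  by rewrite [RHS]big_ord_recl /= scale0r add0r.
rewrite -big_split scaler_sumr; apply: eq_bigr => i _ /=.
by rewrite -scalerDl -natrD subnK // -ltnS.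
Qed.

End DividedPowers.

(** * Truncated flows and deformation of rank bounds *)

Section Deformation.
Variables (F : closedFieldType) (n : nat).
Local Notation V := 'rV[F]_n.+1.
Local Notation P := {poly F}.
Variable br : V -> V -> V.
Hypothesis Lbr : lie_algebra br.
Hypothesis charF : [pchar F] =i pred0.
Local Notation ad := (ad br).
Local Notation cst := (map_mx polyC).
Implicit Types (v z : V) (y w : 'rV[P]_n.+1) (E : 'M[P]_n.+1).

Lemma coef_mx_inj m p (A B : 'M[P]_(m, p)) : (forall i, coef_mx i A = coef_mx i B) -> A = B.
Proof.
move=> H; apply/matrixP=> a b; apply/polyP=> i.
by have /matrixP/(_ a b) := H i; rewrite !mxE.
Qed.

Lemma coef_mx_constM m p r i (A : 'M[F]_(m, p)) (B : 'M[P]_(p, r)) :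
  coef_mx i (cst A *m B) = A *m coef_mx i B.
Proof.
apply/matrixP=> a b; rewrite !mxE coef_sum; apply: eq_bigr => j _.
by rewrite !mxE coefCM.
Qed.

Lemma coef_mx_Mconst m p r i (A : 'M[P]_(m, p)) (B : 'M[F]_(p, r)) :
  coef_mx i (A *m cst B) = coef_mx i A *m B.
Proof.
apply/matrixP=> a b; rewrite !mxE coef_sum; apply: eq_bigr => j _.
by rewrite !mxE coefMC.
Qed.

(** The adjoint map after extension of scalars from [F] to [{poly F}]. *)
Definition ad_poly y : 'M[P]_n.+1 := \sum_i y 0 i *: cst (ad (delta_mx 0 i)).

Lemma ad_sum_delta v : ad v = \sum_i v 0 i *: ad (delta_mx 0 i).
Proof.
rewrite {1}[v]row_sum_delta; elim/big_ind2: _ => [|x A u B <- <-|i _]; first exact: ad0.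
  exact: adD.
exact: adZ.
Qed.

Lemma ad_poly_lin (a : P) y w : ad_poly (a *: y + w) = a *: ad_poly y + ad_poly w.
Proof.
rewrite /ad_poly scaler_sumr -big_split; apply: eq_bigr => i _ /=.
by rewrite !mxE scalerDl scalerA.
Qed.

Lemma coef_ad_poly i y : coef_mx i (ad_poly y) = ad (coef_mx i y).
Proof.
rewrite ad_sum_delta; apply/matrixP=> a b; rewrite !mxE !summxE coef_sum.
by apply: eq_bigr => j _; rewrite !mxE coefMC.
Qed.

Lemma ad_poly_const v : ad_poly (cst v) = cst (ad v).
Proof.
by apply: coef_mx_inj => i; rewrite coef_ad_poly !coef_mx_const; case: eqP; rewrite ?(ad0 Lbr).
Qed.

Lemma ad_poly_rmorph (f : {rmorphism P -> P}) y : (forall c, f c%:P = c%:P) ->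
  map_mx f (ad_poly y) = ad_poly (map_mx f y).
Proof.
move=> fC; rewrite /ad_poly map_mx_sum; apply: eq_bigr => i _.
by rewrite map_mxZ mxE; congr (_ *: _); apply/matrixP=> a b; rewrite !mxE fC.
Qed.

Lemma ad_poly_eval (a : F) y : map_mx (horner_eval a) (ad_poly y) = ad (map_mx (horner_eval a) y).
Proof.
rewrite ad_sum_delta /ad_poly map_mx_sum; apply: eq_bigr => i _.
rewrite map_mxZ mxE; congr (_ *: _); apply/matrixP=> c d.
by rewrite !mxE; exact: hornerC.
Qed.

Definition exp_trunc (M : nat) (Z : 'M[F]_n.+1) : 'M[P]_n.+1 :=
  \matrix_(a, b) \poly_(j < M) divpow Z j a b.

Lemma coef_exp_trunc M Z j : (j < M)%N -> coef_mx j (exp_trunc M Z) = divpow Z j.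
Proof. by move=> jM; apply/matrixP=> a b; rewrite coef_mxE mxE coef_poly jM. Qed.

(** The exponential of a derivation is an automorphism, here modulo ['X^M] and in intertwining form,
    which avoids inverting the truncated exponential. *)
Lemma exp_trunc_congr_const M z v : congr_Xn M
  (exp_trunc M (ad z) *m ad_poly (cst v *m exp_trunc M (ad z)))
  (ad_poly (cst v) *m exp_trunc M (ad z)).
Proof.
apply: congr_Xn_coef => m mM; rewrite ad_poly_const coef_mx_constM coef_exp_trunc //.
rewrite -(divpow_leibniz charF v m (ad_lin Lbr)) => [|u].
  rewrite coef_mxM (reindex_inj rev_ord_inj) /=; apply: eq_bigr => j _.
  have jm : (j <= m)%N by rewrite -ltnS.
  rewrite subSS coef_ad_poly coef_mx_constM subKn // !coef_exp_trunc //.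
    exact: leq_ltn_trans jm mM.
  exact: leq_ltn_trans (leq_subr _ _) mM.
by rewrite (adE Lbr) (ad_br Lbr) addrC subrK.
Qed.

(** The exponential of ['X^N] times [ad z]: its first nonconstant term sits in degree [N], so it can
    correct order [N] without disturbing lower orders. *)
Definition flow M N z : 'M[P]_n.+1 := map_mx (comp_poly 'X^N) (exp_trunc M (ad z)).

Lemma flow_congr M N z y : (0 < N)%N -> congr_Xn M
  (flow M N z *m ad_poly (y *m flow M N z)) (ad_poly y *m flow M N z).
Proof.
move=> N0; set E := flow M N z.
have H v : congr_Xn M (E *m ad_poly (cst v *m E)) (ad_poly (cst v) *m E).
  have [Q HQ] := exp_trunc_congr_const M z v.
  have fC c : comp_poly 'X^N c%:P = c%:P :> P by rewrite comp_polyC.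
  have fcst : map_mx (comp_poly 'X^N) (cst v) = cst v by apply/matrixP=> a b; rewrite !mxE fC.
  have := congr1 (map_mx (comp_poly 'X^N)) HQ.
  rewrite map_mxD map_mxZ !map_mxM !ad_poly_rmorph // map_mxM fcst -/(flow M N z) -/E => ->.
  exists ('X^(N * M - M) *: map_mx (comp_poly 'X^N) Q); rewrite scalerA; congr (_ + _ *: _).
  by rewrite rmorphXn /= comp_polyX -exprM -exprD subnKC // leq_pmull.
have [Q HQ] := fin_all_exists (fun i => H (delta_mx 0 i)).
have Dy : y = \sum_i y 0 i *: cst (delta_mx 0 i).
  rewrite {1}[y]row_sum_delta; apply: eq_bigr => i _; congr (_ *: _).
  by apply/matrixP=> a b; rewrite !mxE; case: (_ && _).
have z0 : ad_poly 0 = 0 by rewrite /ad_poly big1 // => i _; rewrite mxE scale0r.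
exists (\sum_i y 0 i *: Q i).
rewrite {1 2}Dy.
elim: (index_enum _) => [|i r IH]; first by rewrite !big_nil mul0mx !z0 mulmx0 mul0mx scaler0 addr0.
rewrite !big_cons mulmxDl -scalemxAl !ad_poly_lin mulmxDr -scalemxAr IH HQ.
by rewrite mulmxDl -scalemxAl !scalerDr !scalerA ['X^M * _]mulrC addrACA.
Qed.

Lemma coef_flow M N z j : (0 < N)%N -> coef_mx j (flow M N z) =
  if (N %| j)%N && (j %/ N < M)%N then divpow (ad z) (j %/ N) else 0.
Proof.
move=> N0; apply/matrixP=> a b; rewrite coef_mxE 2!mxE coef_comp_poly_Xn // coef_poly.
case: ifP => _ /=; last by rewrite mxE.
by case: ifP => _; last rewrite mxE.
Qed.

Lemma det_flow M N z : (0 < N)%N -> (0 < M)%N -> ~~ root (\det (flow M N z)) 0.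
Proof.
move=> N0 M0; rewrite /root -[_.[0]]/(horner_eval 0 _) -det_map_mx.
have -> : map_mx (horner_eval 0) (flow M N z) = coef_mx 0 (flow M N z).
  by apply/matrixP=> a b; rewrite [LHS]mxE coef_mxE /horner_eval horner_coef0.
rewrite coef_flow // dvdn0 div0n M0 divpow0.
by rewrite det1 oner_eq0.
Qed.

Definition coefs_in (S : 'M[F]_n.+1) y := forall i, (coef_mx i y <= S)%MS.

Lemma coefs_inD S y w : coefs_in S y -> coefs_in S w -> coefs_in S (y + w).
Proof. by move=> Hy Hw i; rewrite coef_mxD addmx_sub. Qed.

Lemma coefs_inN S y : coefs_in S y -> coefs_in S (- y).
Proof. by move=> Hy i; rewrite coef_mxN -scaleN1r scalemx_sub. Qed.

Lemma coefs_inXn S k y : coefs_in S y -> coefs_in S ('X^k *: y).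
Proof. by move=> Hy i; rewrite coef_mxXn; case: ifP; rewrite ?sub0mx. Qed.

Lemma coefs_in_const (S : 'M[F]_n.+1) v : (v <= S)%MS -> coefs_in S (cst v).
Proof. by move=> Hv i; rewrite coef_mx_const; case: ifP; rewrite ?sub0mx. Qed.

Lemma coefs_in_flow S M N z y : (0 < N)%N -> (forall u, (u <= S)%MS -> (br z u <= S)%MS) ->
  coefs_in S y -> coefs_in S (y *m flow M N z).
Proof.
move=> N0 Sz Sy i; rewrite coef_mxM; elim/big_ind: _ => [|u v Hu Hv|j _]; rewrite ?sub0mx ?addmx_sub //.
have dS (u : V) k : (u <= S)%MS -> (u *m divpow (ad z) k <= S)%MS.
  move=> uS; rewrite /divpow -scalemxAr scalemx_sub //; elim: k => [|k IH]; first by rewrite mulmx1.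
  by rewrite exprSr -mulmxE mulmxA (adE Lbr) Sz.
rewrite coef_flow //; case: ifP => _; first exact: dS.
by rewrite mulmx0 sub0mx.
Qed.

Lemma coefs_in_eval S y (a : F) : coefs_in S y -> (map_mx (horner_eval a) y <= S)%MS.
Proof.
move=> Sy; have -> : y = y *m cst (pinvmx S) *m cst S.
  by apply: coef_mx_inj => i; rewrite !coef_mx_Mconst mulmxKpV.
rewrite map_mxM (_ : map_mx _ (cst S) = S) ?submxMl //.
by apply/matrixP=> i j; rewrite !mxE; exact: hornerC.
Qed.

(** * Spreading a rank bound from a slice [U] to [W], where [W] is covered by [U] and [[K], [x]] *)

Variables (U W K : 'M[F]_n.+1) (x : V) (k : nat).
Hypotheses (UW : (U <= W)%MS) (rankU : forall u : V, (u <= U)%MS -> (\rank (ad u *m ad u) <= k)%N)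
  (KW : forall z (w : V), (z <= K)%MS -> (w <= W)%MS -> (br z w <= W)%MS)
  (WUK : forall w : V, (w <= W)%MS -> exists u z, [/\ (u <= U)%MS, (z <= K)%MS & w = u + br z x]).

(** Every value of [u] lies in [U], so the minor is a polynomial vanishing at all points of an
    infinite field, hence zero. *)
Lemma minors_vanish_slice M u : coefs_in U u -> minors_vanish k M (ad_poly u *m ad_poly u).
Proof.
move=> Uu L R; suff -> : \det (L *m (ad_poly u *m ad_poly u) *m R) = 0 by apply: dvdp0.
apply/eqP/negPn/negP => /closed_nonrootP[a /negP]; apply; apply/eqP.
rewrite -[_.[_]]/(horner_eval a _) -det_map_mx !map_mxM !ad_poly_eval.
by apply: (proj1 (rank_le_det _ _)); apply/rankU/coefs_in_eval.
Qed.

(* Newton iteration: a curve agreeing with the slice [U] up to order [N] is moved by the flow of a suitable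
   element of [K] to one agreeing with it up to order [N + 1]. *)
Lemma minors_vanish_curve M d N (u w : 'rV[P]_n.+1) :
    (0 < N)%N -> (M <= N + d)%N -> coefs_in U u -> coef_mx 0 u = x -> coefs_in W w ->
  minors_vanish k M (ad_poly (u + 'X^N *: w) *m ad_poly (u + 'X^N *: w)).
Proof.
elim: d N u w => [|d IH] N u w N0 MN Uu ux Ww.
  rewrite addn0 in MN; apply: minors_vanish_congr (minors_vanish_slice M Uu).
  have C : congr_Xn M (ad_poly u) (ad_poly (u + 'X^N *: w)).
    apply: congr_Xn_sym; exists ('X^(N - M) *: ad_poly w).
    by rewrite addrC ad_poly_lin scalerA -exprD subnKC // addrC.
  exact: congr_Xn_trans (congr_XnMl _ C) (congr_XnMr _ C).
have [MN'|NM] := leqP M N; first by apply: IH => //; rewrite (leq_trans MN') // leq_addr.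
have M0 : (0 < M)%N by apply: leq_ltn_trans NM.
set y := u + 'X^N *: w.
have [u1 [z1 [U1 K1 Dw0]]] := WUK (Ww 0%N).
(* With [w_0 = u1 + br z1 x] the error at order [N], the flow of [- z1] adds [- br z1 x] at that
   order; what remains, [u1], is absorbed into the slice curve [u']. *)
pose z := - z1; pose E := flow M N z; pose u' := u + 'X^N *: cst u1.
have zW v : (v <= W)%MS -> (br z v <= W)%MS.
  by move=> vW; rewrite /z (brNl Lbr) -scaleN1r scalemx_sub // KW.
have inW S y1 : (S <= W)%MS -> coefs_in S y1 -> coefs_in W y1.
  by move=> SW Sv i; apply: submx_trans SW.
have Uu' : coefs_in U u' by apply: coefs_inD => //; apply/coefs_inXn/coefs_in_const.
have Wy : coefs_in W y by apply: coefs_inD; [apply: inW Uu | apply: coefs_inXn].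
have y0 : coef_mx 0 y = x by rewrite coef_mxD coef_mxXn N0 addr0.
have e0 i j : (j < i < N)%N || (0 < j < i)%N && (i == N) -> coef_mx (i - j) E = 0.
  move=> H; rewrite coef_flow //; case: ifP => // /andP[/dvdn_leq]; rewrite subn_gt0.
  by move: H; lia.
have e1 : coef_mx 0 E = 1%:M by rewrite coef_flow // dvdn0 div0n M0 divpow0.
have eN : coef_mx N E = ad z.
  by rewrite coef_flow // dvdnn divnn N0 (leq_ltn_trans N0 NM) divpow1.
have low i : (i < N.+1)%N -> coef_mx i (y *m E - u') = 0.
  rewrite ltnS leq_eqVlt => /predU1P[->|iN]; rewrite coef_mxD coef_mxN coef_mxM coef_mxD.
    rewrite (bigD1 ord0) //= subn0 y0 eN (bigD1 ord_max) /=; last by rewrite -(inj_eq val_inj) /= -lt0n.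
    rewrite subnn e1 mulmx1 big1 => [|j]; last first.
      rewrite -!(inj_eq val_inj) /= => /andP[j0 jN]; rewrite e0 ?mulmx0 //.
      by rewrite eqxx andbT lt0n j0 ltn_neqAle jN -ltnS ltn_ord orbT.
    rewrite addr0 coef_mxD !coef_mxXn ltnn subnn coef_mx_const /= Dw0 (adE Lbr) /z (brNl Lbr).
    by apply/eqP; rewrite subr_eq0 addrC !addrA addrK.
  rewrite coef_mxXn iN addr0 (bigD1 ord_max) //= subnn e1 mulmx1 big1 => [|j]; last first.
    rewrite -(inj_eq val_inj) /= => ji; rewrite e0 ?mulmx0 //.
    by rewrite ltn_neqAle ji -ltnS ltn_ord iN.
  by rewrite addr0 coef_mxD coef_mxXn iN addr0 subrr.
have [B [DB HB]] := mx_split_Xn low.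
have WB : coefs_in W B.
  move=> i; rewrite HB; apply: (coefs_inD (coefs_in_flow _ N0 zW Wy) _ _) => //.
  by apply: coefs_inN; apply: inW Uu'.
have Dy' : y *m E = u' + 'X^(N.+1) *: B by rewrite -DB addrC subrK.
have ux' : coef_mx 0 u' = x by rewrite coef_mxD coef_mxXn N0 addr0.
have := IH N.+1 u' B (ltn0Sn _) _ Uu' ux' WB; rewrite addSn -addnS => /(_ MN).
rewrite -Dy'; have C := flow_congr M z y N0.
apply: (minors_vanish_conj (det_flow z N0 M0)).
rewrite mulmxA; apply: congr_Xn_trans (congr_XnMr _ C) _.
by rewrite -!mulmxA; apply: congr_XnMl.
Qed.

(** The segment from [x] to [v] is a curve starting at order 1. A minor [q] along it is divisible by
    ['X] to the power [size q], which exceeds its degree, so [q] vanishes identically and in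
    particular at the endpoint 1. *)
Lemma ad_sqr_rank_deform v : (x <= U)%MS -> (v <= W)%MS -> (\rank (ad v *m ad v) <= k)%N.
Proof.
move=> xU vW; apply/rank_le_det => L R.
pose y := cst x + 'X^1 *: cst (v - x).
set q := \det (cst L *m (ad_poly y *m ad_poly y) *m cst R).
have q0 : q = 0.
  apply/eqP/negPn/negP => q0; have := @minors_vanish_curve (size q) (size q) 1 (cst x) (cst (v - x)).
  rewrite leq_addl coef_mx_const => /(_ isT isT (coefs_in_const xU) erefl).
  have Wvx : (v - x <= W)%MS by rewrite addmx_sub // -scaleN1r scalemx_sub // (submx_trans xU).
  move=> /(_ (coefs_in_const Wvx) (cst L) (cst R)) /(dvdp_leq q0).
  by rewrite size_polyXn ltnn.
have := congr1 (horner_eval 1) q0; rewrite /q -det_map_mx !map_mxM !ad_poly_eval.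
have ev m p (A : 'M[F]_(m, p)) : map_mx (horner_eval 1) (cst A) = A.
  by apply/matrixP=> a b; rewrite !mxE; exact: hornerC.
rewrite !ev /y map_mxD map_mxZ !ev [_ 'X^1](_ : _ = 1); last by rewrite /= /horner_eval hornerXn expr1n.
rewrite scale1r addrC subrK => ->.
exact: horner0.
Qed.

End Deformation.

(** * Lifting Cartan subspaces *)

Section Eigenspaces.
Variables (F : closedFieldType) (n : nat).
Hypothesis charF : [pchar F] =i pred0.
Implicit Types (s U A B : 'M[F]_n.+1).

Lemma half_double (v : 'rV[F]_n.+1) : 2%:R^-1 *: (v + v) = v.
Proof.
by rewrite -mulr2n -scaler_nat scalerA mulVf ?scale1r // (proj1 (pcharf0P F) charF).
Qed.

Lemma eigsp_disjoint s A B : (A <= eigsp s 1)%MS -> (B <= eigsp s (-1))%MS -> (A :&: B)%MS = 0.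
Proof.
move=> As Bs; apply/eqP/rowV0P => v; rewrite sub_capmx => /andP[vA vB].
have /eigspP v1 := submx_trans vA As; have /eigspP v2 := submx_trans vB Bs.
by apply: (double_mx_eq0 charF); rewrite -{1}[v]scale1r -v1 v2 scaleN1r addNr.
Qed.

Lemma eigsp_split_rank s U : s *m s = 1%:M -> (U *m s <= U)%MS ->
  \rank U = (\rank (U :&: eigsp s 1)%MS + \rank (U :&: eigsp s (-1))%MS)%N.
Proof.
move=> ss Us; rewrite -mxrank_disjoint_sum; last by apply: (@eigsp_disjoint s); exact: capmxSr.
apply/eqP; rewrite eqn_leq; apply/andP; split; last first.
  by apply: mxrankS; rewrite addsmx_sub !capmxSl.
apply/mxrankS/rV_subP => v vU.
have vsU : (v *m s <= U)%MS by apply: submx_trans Us; apply: submxMr.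
rewrite -[v]half_double; apply: scalemx_sub.
have -> : v + v = (v + v *m s) + (v - v *m s) by rewrite addrACA subrr addr0.
apply: addmx_sub_adds; rewrite sub_capmx.
  rewrite addmx_sub //=; apply/eigspP.
  by rewrite mulmxDl -mulmxA ss mulmx1 scale1r addrC.
rewrite addmx_sub -?scaleN1r ?scalemx_sub //=; apply/eigspP.
by rewrite mulmxDl -scalemxAl -mulmxA ss mulmx1 scalerDr scalerA mulrNN mulr1 scale1r addrC.
Qed.

End Eigenspaces.

Section Lift.
Variables (F : closedFieldType) (n : nat).
Local Notation V := 'rV[F]_n.+1.
Variable br : V -> V -> V.
Hypotheses (Lbr : lie_algebra br) (charF : [pchar F] =i pred0) (ss : semisimple_lie br).
Local Notation ad := (ad br).
Implicit Types (u v w x y z a c : V).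
Variables s1 s2 C : 'M[F]_n.+1.
Hypotheses (inv1 : involution br s1) (inv2 : involution br s2) (s12 : s1 *m s2 = s2 *m s1)
  (max1 : maximal_rank br s1) (cC : cartan_subspace br (gij s1 s2 1 1) C).

Lemma br_eigsp (s : 'M[F]_n.+1) e f u v : involution br s ->
  (u <= eigsp s e)%MS -> (v <= eigsp s f)%MS -> (br u v <= eigsp s (e * f))%MS.
Proof.
move=> inv_s /eigspP us /eigspP vs; apply/eigspP.
by rewrite (br_inv inv_s) us vs (brZl Lbr) (brZr Lbr) scalerA.
Qed.

Lemma ker_adP x v : reflect (br x v = 0) (v <= kermx (ad x))%MS.
Proof. by apply: (iffP sub_kermxP); rewrite (adE Lbr). Qed.

Lemma ker_ad_inv (s : 'M[F]_n.+1) x v : involution br s -> (x <= eigsp s (-1))%MS ->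
  br x v = 0 -> br x (v *m s) = 0.
Proof.
move=> inv_s /eigspP xs xv.
have -> : x = - (x *m s) by rewrite xs scaleN1r opprK.
by rewrite (brNl Lbr) -(br_inv inv_s) xv mul0mx oppr0.
Qed.

Let Cg : (C <= gij s1 s2 1 1)%MS. Proof. by case: cC. Qed.

Lemma cartan_in_eigsp c : (c <= C)%MS -> (c <= eigsp s1 (-1))%MS /\ (c <= eigsp s2 (-1))%MS.
Proof. by move=> cCC; have := submx_trans cCC Cg; rewrite sub_capmx !expr1 => /andP. Qed.

(** * The centralizer of a generic element, graded by eigenvalues: [l 1 (-1)] is l_01 and [l (-1) 1]
    is l_10 *)

Section GenericElement.
Variable x : V.
Hypotheses (xC : (x <= C)%MS)
  (genx : forall v, v *m ad x ^+ n.+1 = 0 -> forall y, (y <= C)%MS -> v *m ad y ^+ n.+1 = 0).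
Local Notation Z := (kermx (ad x)).
Local Notation l e f := (eigsp s1 e%R :&: Z :&: eigsp s2 f%R)%MS.

Let x1 : (x <= eigsp s1 (-1))%MS. Proof. by have [] := cartan_in_eigsp xC. Qed.
Let x2 : (x <= eigsp s2 (-1))%MS. Proof. by have [] := cartan_in_eigsp xC. Qed.

Lemma centralizes v c : (v <= Z)%MS -> (c <= C)%MS -> br c v = 0.
Proof.
move=> /ker_adP xv cCC; case: (cC) => _ cssC _.
exact: (semisimple_centralizer Lbr cssC genx).
Qed.

Lemma centralizer11_sub : (l (-1) (-1) <= C)%MS.
Proof.
apply/rV_subP=> v; rewrite !sub_capmx -andbA => /and3P[v1 vZ v2].
apply: (cartan_centralizer Lbr charF ss inv1 inv2 s12 cC) => [|c cCC].
  by rewrite sub_capmx !expr1 v1.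
exact: centralizes.
Qed.

Lemma centralizer_split e : \rank (eigsp s1 e :&: Z)%MS = (\rank (l e 1) + \rank (l e (-1)))%N.
Proof.
have [_ i2 _] := inv2; apply: eigsp_split_rank => //.
apply/rV_subP=> v /submxP[w ->]; rewrite mulmxA.
have := submxMl w (eigsp s1 e :&: Z)%MS; move: (w *m _) => {}v.
rewrite !sub_capmx => /andP[/eigspP v1 /ker_adP xv]; apply/andP; split.
  by apply/eigspP; rewrite -mulmxA -s12 mulmxA v1 -scalemxAl.
exact/ker_adP/ker_ad_inv.
Qed.

(** Split [u = a + c] by [s2]; then [c] lies in [C] and kills [Z], so [u] acts on [Z] as [a],
    reversing the [s1]-sign and keeping the [s2]-sign. The kernel [T] on [l (-1) 1] has codimension
    at most the rank of its target [l 1 1], which is why that rank stands on the right. *)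
Lemma slice_nullity u : (u <= eigsp s1 (-1) :&: Z)%MS ->
  (\rank (ad u *m ad u) + (\rank (l 1 (-1)) + \rank (l (-1) (-1)) + \rank (l (-1) 1))
     <= n.+1 + \rank (l 1 1))%N.
Proof.
rewrite sub_capmx => /andP[u1 uZ]; have xu := ker_adP _ _ uZ.
have uK := invK inv2 u.
pose a := 2%:R^-1 *: (u + u *m s2); pose c := 2%:R^-1 *: (u - u *m s2).
have uac : u = a + c.
  by rewrite /a /c -scalerDr addrACA subrr addr0 half_double.
have u2Z : (u *m s2 <= Z)%MS by apply/ker_adP/ker_ad_inv.
have u21 : (u *m s2 <= eigsp s1 (-1))%MS.
  by apply/eigspP; rewrite -mulmxA -s12 mulmxA (eigspP _ _ _ u1) -scalemxAl.
have aZ : (a <= Z)%MS by rewrite scalemx_sub // addmx_sub.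
have a1 : (a <= eigsp s1 (-1))%MS by rewrite scalemx_sub // addmx_sub.
have a2 : (a <= eigsp s2 1)%MS.
  by rewrite scalemx_sub //; apply/eigspP; rewrite mulmxDl uK scale1r addrC.
have cCC : (c <= C)%MS.
  apply: submx_trans centralizer11_sub; rewrite !sub_capmx -andbA; apply/and3P; split.
  - by rewrite scalemx_sub // addmx_sub // -scaleN1r scalemx_sub.
  - by rewrite scalemx_sub // addmx_sub // -scaleN1r scalemx_sub.
  - by rewrite scalemx_sub //; apply/eigspP; rewrite mulmxBl uK scaleN1r opprB.
have brua v : (v <= Z)%MS -> br u v = br a v.
  by move=> vZ; rewrite uac (brDl Lbr) (centralizes vZ cCC) addr0.
have brZ v : (v <= Z)%MS -> (br a v <= Z)%MS.
  move=> /ker_adP xv; apply/ker_adP; rewrite (jacobi Lbr) xv (br0r Lbr) addr0.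
  by rewrite (ker_adP _ _ aZ) (br0l Lbr).
have inl e f v : (v <= l e f)%MS -> (br u v <= l (-1 * e) (1 * f))%MS.
  rewrite !sub_capmx -!andbA => /and3P[v1 vZ v2]; rewrite brua //.
  by rewrite (br_eigsp inv1 a1 v1) brZ // (br_eigsp inv2 a2 v2).
have CZ v : (v <= C)%MS -> br u v = 0.
  by move=> vC; rewrite (brC Lbr) (centralizes uZ vC) oppr0.
set T := (l (-1) 1 :&: kermx (ad u))%MS.
have rT : (\rank (l (-1) 1) <= \rank T + \rank (l 1 1))%N.
  rewrite -(mxrank_mul_ker (l (-1) 1) (ad u)) addnC leq_add2l; apply: mxrankS.
  apply/rV_subP=> v /submxP[w ->]; rewrite mulmxA (adE Lbr).
  by have := inl _ _ _ (submxMl w (l (-1) 1)); rewrite mulrNN !mulr1.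
have sub : (l 1 (-1) + (l (-1) (-1) + T) <= kermx (ad u *m ad u))%MS.
  rewrite !addsmx_sub; apply/and3P; split; apply/rV_subP => v vl; apply/sub_kermxP;
    rewrite mulmxA !(adE Lbr).
  - apply/CZ/(submx_trans _ centralizer11_sub).
    by have := inl _ _ _ vl; rewrite mulr1 mul1r.
  - by rewrite (CZ v) ?(br0r Lbr) //; apply: submx_trans centralizer11_sub.
  - move: vl; rewrite sub_capmx => /andP[_ /ker_adP->]; exact: br0r.
have l1 e f : (l e f <= eigsp s1 e)%MS by rewrite -capmxA capmxSl.
have dis2 : (l (-1) (-1) :&: T)%MS = 0.
  rewrite capmxC; apply: (@eigsp_disjoint _ _ charF s2); last exact: capmxSr.
  by apply: submx_trans (capmxSl _ _) (capmxSr _ _).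
have dis1 : (l 1 (-1) :&: (l (-1) (-1) + T))%MS = 0.
  apply: (@eigsp_disjoint _ _ charF s1) => //.
  by rewrite addsmx_sub l1; apply: submx_trans (capmxSl _ _) (l1 _ _).
have arith (r p q g d t m : nat) : (r <= m -> g <= t + d -> p + (q + t) <= m - r ->
    r + (p + q + g) <= m + d)%N by clear; lia.
apply: arith (rank_leq_row _) rT _.
by have := mxrankS sub; rewrite !mxrank_disjoint_sum // mxrank_ker.
Qed.

(** Decompose [w] along kernel and image of the semisimple [ad x], then average over [s1]. The sign
    of [z] reflects [br z x] in place of [br x z]. *)
Lemma slice_transversal w : (w <= eigsp s1 (-1))%MS ->
  exists u z, [/\ (u <= eigsp s1 (-1)%R :&: Z)%MS, (z <= eigsp s1 1)%MS & w = u + br z x].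
Proof.
move=> /eigspP ws; case: (cC) => _ [_ sC] _.
have [a [v [Dw xa]]] := semisimple_ker_im Lbr w (sC x xC).
have xs := eigspP _ _ _ x1.
exists (2%:R^-1 *: (a - a *m s1)), (- (2%:R^-1 *: (v + v *m s1))); split.
- rewrite scalemx_sub // sub_capmx; apply/andP; split.
    by apply/eigspP; rewrite mulmxBl (invK inv1) scaleN1r opprB.
  apply/ker_adP; rewrite (brDr Lbr) (brNr Lbr) xa add0r.
  by rewrite (ker_ad_inv inv1 x1 xa) oppr0.
- rewrite -scaleN1r !scalemx_sub //; apply/eigspP.
  by rewrite mulmxDl (invK inv1) scale1r addrC.
rewrite (brNl Lbr) (brC Lbr) opprK (brZr Lbr) -scalerDr (brDr Lbr).
have -> : br x (v *m s1) = - (br x v *m s1).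
  by rewrite (br_inv inv1) xs scaleN1r (brNl Lbr) opprK.
rewrite addrACA -Dw -opprD -mulmxDl -Dw ws scaleN1r opprK.
by rewrite half_double.
Qed.

(* The Kostant-Rallis identity at [x] and the deformation from the slice force a nullity of at least
   [dim h + 2 dim l 1 (-1)] on the whole (-1)-eigenspace, against [dim h] at a generic element of [h]. *)
Lemma centralizer01_eq0 : l 1 (-1) = 0.
Proof.
case: max1 => h csah hs.
have [ah [y [yh geny]]] := cartan_subalgebra_generic Lbr charF inv1 csah hs.
have ys := submx_trans yh hs.
have KRx := kostant_rallis Lbr charF ss inv1 x1.
have KRy := kostant_rallis Lbr charF ss inv1 ys.
have kerh m (v : V) : v *m ad y ^+ m = 0 -> (v <= h)%MS.
  move=> Hv; apply: geny; have := @gen_eigen_bound _ _ (ad y) v 0 m.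
  by rewrite raddf0 subr0; apply.
(* The kernel of [ad y] lies in [h], hence in the (-1)-eigenspace. *)
have k0 : \rank (eigsp s1 1 :&: kermx (ad y))%MS = 0%N.
  apply/eqP; rewrite mxrank_eq0 -submx0 -(@eigsp_disjoint _ _ charF s1 _ _ (submx_refl _) (submx_refl _)).
  rewrite sub_capmx capmxSl; apply/rV_subP=> v; rewrite sub_capmx => /andP[_ /sub_kermxP vy].
  by apply: submx_trans hs; apply: (kerh 1%N); rewrite expr1.
have hker : (\rank h <= \rank (eigsp s1 (-1)%R :&: kermx (ad y))%MS)%N.
  apply: mxrankS; rewrite sub_capmx hs; apply/rV_subP => v vh; apply/ker_adP; exact: ah.
have nully : (n.+1 <= \rank (ad y *m ad y) + \rank h)%N.
  have : (kermx (ad y *m ad y) <= h)%MS.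
    apply/rV_subP=> v /sub_kermxP vy; apply: (kerh 2%N).
    by rewrite expr2 -mulmxE.
  move/mxrankS; rewrite mxrank_ker; have := rank_leq_row (ad y *m ad y); lia.
pose k := (n.+1 + \rank (l 1 1) - (\rank (l 1 (-1)) + \rank (l (-1) (-1)) + \rank (l (-1) 1)))%N.
have rk : (\rank (ad y *m ad y) <= k)%N.
  apply: (@ad_sqr_rank_deform F n br Lbr charF (eigsp s1 (-1) :&: Z)%MS (eigsp s1 (-1)) (eigsp s1 1) x k) => //.
  - exact: capmxSl.
  - by move=> u /slice_nullity; rewrite /k; lia.
  - by move=> z w zK wW; have := br_eigsp inv1 zK wW; rewrite mul1r.
  - exact: slice_transversal.
  - by rewrite sub_capmx x1; apply/ker_adP/(brxx Lbr).
have e1 := centralizer_split 1; have e2 := centralizer_split (-1).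
apply/eqP; rewrite -mxrank_eq0; apply/eqP.
(* The bound at [u = 0] shows that the truncated subtraction defining [k] is exact. *)
have := slice_nullity (sub0mx _ _); rewrite (ad0 Lbr) mulmx0 mxrank0.
move: rk; rewrite /k; lia.
Qed.

End GenericElement.

(** An element [d] of a larger [D] commutes with the generic [x]. Its symmetrisation [d + d *m s1]
    lies in [l 1 (-1) = 0], so [d] is in [gij 1 1] and centralizes [C], hence belongs to [C]. *)
Lemma cartan_subspace_lift : cartan_subspace br (gij s1 s2 0 1 + gij s1 s2 1 1)%MS C.
Proof.
have [_ cssC _] := cC; have [aC _] := cssC.
have [x [xC genx]] := generic_element Lbr aC.
split=> [||D CD DW cssD]; [exact: submx_trans Cg (addsmxSr _ _) | by [] |].
apply/rV_subP=> d dD; have [aD _] := cssD.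
have D2 : (d <= eigsp s2 (-1))%MS.
  apply: submx_trans dD (submx_trans DW _); rewrite addsmx_sub.
  by apply/andP; split; apply: submx_trans (capmxSr _ _) _; rewrite expr1.
have xd : br x d = 0 by apply: aD => //; apply: submx_trans CD.
have [x1 _] := cartan_in_eigsp xC.
have d1 : d + d *m s1 = 0.
  apply: sub0P; rewrite -(centralizer01_eq0 xC genx) !sub_capmx -andbA; apply/and3P; split.
  - by apply/eigspP; rewrite mulmxDl (invK inv1) scale1r addrC.
  - by apply/ker_adP; rewrite (brDr Lbr) xd (ker_ad_inv inv1 x1 xd) addr0.
  - by apply/eigspP; rewrite mulmxDl -mulmxA s12 mulmxA (eigspP _ _ _ D2) -scalemxAl -scalerDr.
apply: (cartan_centralizer Lbr charF ss inv1 inv2 s12 cC) => [|c cCC].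
  apply/gijP; rewrite !expr1; split; last exact/eigspP.
  by rewrite scaleN1r; apply/eqP; rewrite -addr_eq0 addrC d1.
by apply: aD => //; apply: submx_trans CD.
Qed.

End Lift.

(** * Transport to the pair formed with the product involution *)

Lemma cartan_subspace_eqmx (F : fieldType) n (br : 'rV[F]_n -> 'rV[F]_n -> 'rV[F]_n)
    (W W' C : 'M[F]_n) :
  (W == W')%MS -> cartan_subspace br W C -> cartan_subspace br W' C.
Proof.
case/andP=> WW' W'W [CW cC mC]; split=> //; first exact: submx_trans WW'.
by move=> D CD DW; apply: mC => //; apply: submx_trans W'W.
Qed.

(** Indices are natural numbers, not residues modulo 2; the sign hypothesis lets [k = 0] stand for
    [1 + 1]. *)
Lemma gij_product (F : closedFieldType) n (s1 s2 : 'M[F]_n.+1) (i j k : nat) :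
    s1 *m s1 = 1%:M -> (-1) ^+ k = (-1) ^+ (i + j) :> F ->
  (gij s1 (s1 *m s2) i j == gij s1 s2 i k)%MS.
Proof.
move=> s11 Dk; have K (v : 'rV[F]_n.+1) : v *m s1 *m s1 = v by rewrite -mulmxA s11 mulmx1.
have sgn : (-1) ^+ i * (-1) ^+ i = 1 :> F by rewrite -exprD addnn -mul2n exprM sqrrN expr1n expr1n.
apply/andP; split; apply/rV_subP=> v /gijP[v1 v2]; apply/gijP; split=> //.
  rewrite Dk exprD -scalerA -v2 mulmxA v1 -scalemxAl scalerA sgn scale1r //.
by rewrite mulmxA v1 -scalemxAl v2 scalerA Dk exprD mulrA sgn mul1r.
Qed.

Theorem theorem3p3 (F : closedFieldType) (n : nat)
  (br : 'rV[F]_n -> 'rV[F]_n -> 'rV[F]_n) (s1 s2 s3 : 'M[F]_n) :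
  [pchar F] =i pred0 ->
  lie_algebra br -> semisimple_lie br ->
  involution br s1 -> involution br s2 -> involution br s3 ->
  s1 *m s2 = s2 *m s1 -> s1 != s2 -> s3 = s1 *m s2 ->
  maximal_rank br s1 ->
  (forall c11 : 'M[F]_n,
     cartan_subspace br (gij s1 s2 1 1) c11 ->
     cartan_subspace br (gij s1 s2 0 1 + gij s1 s2 1 1)%MS c11) /\
  (forall c10 : 'M[F]_n,
     cartan_subspace br (gij s1 s2 1 0) c10 ->
     cartan_subspace br (gij s1 s2 1 0 + gij s1 s2 0 1)%MS c10).
Proof.
case: n br s1 s2 s3 => [|n'] br' t1 t2 t3 charF Lbr ss inv1 inv2 inv3 t12 _ Dt3 max1.
  (* In dimension zero every matrix is the identity, so there is no involution. *)
  by case: inv1 => _ _; rewrite [t1]flatmx0 [1%:M]flatmx0 eqxx.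
split=> C cC; first exact: cartan_subspace_lift.
have [_ t11 _] := inv1.
have t13 : t1 *m t3 = t3 *m t1 by rewrite Dt3 -mulmxA -t12.
have P11 : (gij t1 t3 1 1 == gij t1 t2 1 0)%MS by rewrite Dt3 gij_product // sqrrN expr1n.
have P01 : (gij t1 t3 0 1 == gij t1 t2 0 1)%MS by rewrite Dt3 gij_product.
have cC3 : cartan_subspace br' (gij t1 t3 1 1) C by apply: cartan_subspace_eqmx cC; rewrite andbC.
have := cartan_subspace_lift Lbr charF ss inv1 inv3 t13 max1 cC3.
apply: cartan_subspace_eqmx; apply/eqmxP; rewrite addsmxC.
exact: adds_eqmx (eqmxP P11) (eqmxP P01).
Qed.
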